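(* Let $\phi\in\Gamma_0(\mathbb{R}^m)$ be Legendre, super-coercive and $\mathcal{C}^2$ on $\operatorname{int}(\operatorname{dom}\phi)$, and let $f:\mathbb{R}^m\to\overline{\mathbb{R}}$ be proper, lsc and prox-bounded relative to $\phi$ with threshold $\lambda_f$. Let $f$ be relatively prox-regular (relative to $\phi$) at $\bar x\in\operatorname{int}(\operatorname{dom}\phi)\cap\operatorname{dom}f$ for $\bar v\in\partial f(\bar x)$. If $\lambda\in\,]0,\lambda_f[$ is sufficiently small, then $\overleftarrow{\operatorname{env}}^{\phi}_{\lambda}f$ is $\mathcal{C}^1$ around $\bar y:=\nabla\phi^*(\nabla\phi(\bar x)+\lambda\bar v)$ with $$\nabla\overleftarrow{\operatorname{env}}^{\phi}_{\lambda}f(y)=\frac1\lambda\nabla^2\phi(y)\big(y-\overleftarrow{\operatorname{prox}}^{\phi}_{\lambda}f(y)\big)$$ for $y$ sufficiently close to $\bar y$. If, furthermore, $\phi$ is very strictly convex and $\nabla^2\phi$ is locally Lipschitz on $\operatorname{int}(\operatorname{dom}\phi)$, then $\nabla\overleftarrow{\operatorname{env}}^{\phi}_{\lambda}f$ is Lipschitz continuous on a neighborhood of $\bar y$.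
   Context: $\overline{\mathbb{R}}=\mathbb{R}\cup\{-\infty,\infty\}$; $\Gamma_0(\mathbb{R}^m)$ is the set of proper lsc convex functions $\mathbb{R}^m\to\overline{\mathbb{R}}$. $\phi\in\Gamma_0(\mathbb{R}^m)$ is Legendre if it is essentially smooth ($\operatorname{int}(\operatorname{dom}\phi)\neq\emptyset$, $\phi$ is differentiable on $\operatorname{int}(\operatorname{dom}\phi)$, and $\|\nabla\phi(x^\nu)\|\to\infty$ whenever $x^\nu\to x\in\operatorname{bdry}\operatorname{dom}\phi$) and essentially strictly convex (strictly convex on every convex subset of $\operatorname{dom}\partial\phi$). Then $\nabla\phi:\operatorname{int}(\operatorname{dom}\phi)\to\operatorname{int}(\operatorname{dom}\phi^* )$ is a bijection with inverse $\nabla\phi^*$ ($\phi^*$ the convex conjugate). Super-coercive: $\phi(x)/\|x\|\to\infty$ as $\|x\|\to\infty$ (equivalently $\operatorname{dom}\phi^*=\mathbb{R}^m$). Very strictly convex: $\phi$ is $\mathcal{C}^2$ on $\operatorname{int}(\operatorname{dom}\phi)\ne\emptyset$ with $\nabla^2\phi(x)$ positive definite for all $x\in\operatorname{int}(\operatorname{dom}\phi)$. $D_\phi(x,y)=\phi(x)-\phi(y)-\langle\nabla\phi(y),x-y\rangle$ if $y\in\operatorname{int}(\operatorname{dom}\phi)$, $+\infty$ otherwise. For $\lambda>0$: $\overleftarrow{\operatorname{env}}^{\phi}_{\lambda}f(y)=\inf_{x} f(x)+\frac1\lambda D_\phi(x,y)$ and $\overleftarrow{\operatorname{prox}}^{\phi}_{\lambda}f(y)=\operatorname{argmin}_{x}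 f(x)+\frac1\lambda D_\phi(x,y)$ over $x\in\mathbb{R}^m$. The gradient formula includes the assertion that the prox is single-valued at the points concerned (and is identified with its single element). $f$ is prox-bounded relative to $\phi$ if there is $\lambda>0$ with $\overleftarrow{\operatorname{env}}^{\phi}_{\lambda}f(y)>-\infty$ for some $y\in\operatorname{int}(\operatorname{dom}\phi)$; the threshold $\lambda_f$ is the supremum of all such $\lambda$. $\partial f$ is the limiting (Mordukhovich) subdifferential. $f$ is locally lsc at $\bar x$ (where $f$ is finite) if there is $\epsilon>0$ such that all sets $\{x:\|x-\bar x\|\le\epsilon,\ f(x)\le\alpha\}$ with $\alpha\le f(\bar x)+\epsilon$ are closed. $f$ is relatively prox-regular at $\bar x\in\operatorname{int}(\operatorname{dom}\phi)$ for $\bar v$ if $f$ is finite and locally lsc at $\bar x$, $\bar v\in\partial f(\bar x)$, and there exist $\epsilon>0$, $r\ge0$ such that for all $\|x'-\bar x\|<\epsilon$, $\|x-\bar x\|<\epsilon$ (with $\epsilon$ sufficiently small that $x,x'\in\operatorname{int}(\operatorname{dom}\phi)$), $f(x')\ge f(x)+\langle v,x'-x\rangle-rD_\phi(x',x)$ whenever $f(x)-f(\bar x)<\epsilon$, $v\in\partial f(x)$, $\|v-\bar v\|<\epsilon$. *)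

(* Defs.v *)
From HB Require Import structures.
From mathcomp Require Import all_boot all_order all_algebra.
From mathcomp Require Import all_classical all_reals all_analysis.

Set Implicit Arguments.
Unset Strict Implicit.
Unset Printing Implicit Defensive.

Import Order.TTheory GRing.Theory Num.Theory.
Import numFieldNormedType.Exports.

Local Open Scope classical_set_scope.
Local Open Scope ring_scope.

(* The norm `|x| of the library on 'rV[R]_m is the max norm; it induces the same
   topology as the Euclidean norm [enorm], which is used below wherever a norm
   occurs explicitly, except in the Lipschitz properties: these do not depend on
   the choice of norms, and are stated with the library's [lipschitz _ | _]. *)
Definition dotv {R : realType} {m : nat} (u v : 'rV[R]_m) : R :=
  (u *m v^T) 0 0.

Definition enorm {R : realType} {m : nat} (u : 'rV[R]_m) : R :=
  Num.sqrt (dotv u u).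

Section ExtendedRealFunctions.
Context {R : realType} {m : nat}.
Implicit Types (f g phi : 'rV[R]_m -> \bar R) (x y u v w : 'rV[R]_m).
Implicit Types (A C U : set 'rV[R]_m).

Definition edom f : set 'rV[R]_m := [set x | (f x < +oo)%E].

Definition eproper f : Prop :=
  (forall x, (-oo < f x)%E) /\ (exists x, (f x < +oo)%E).

(* Only applied to functions that never take the value -oo. *)
Definition econvex f : Prop :=
  forall x y (t : R), 0 < t -> t < 1 ->
    (f (t *: x + (1 - t) *: y)%R <= t%:E * f x + (1 - t)%:E * f y)%E.

Definition Gamma0 f : Prop :=
  [/\ eproper f, lower_semicontinuous f & econvex f].

Definition bdry A : set 'rV[R]_m := closure A `\` A°.

Definition grad (h : 'rV[R]_m -> R) x : 'rV[R]_m :=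
  \row_i 'D_(delta_mx 0 i) h x.

(* An extended-real-valued function is differentiable at x when it is finite
   near x and its real part is differentiable at x. *)
Definition ediff f x : Prop :=
  (\forall y \near x, f y \is a fin_num) /\ differentiable (fine \o f) x.

Definition egrad f : 'rV[R]_m -> 'rV[R]_m := grad (fine \o f).

(* With row vectors, the Hessian applied to w is [w *m hessian f x]. *)
Definition hessian f x : 'M[R]_m := 'J (egrad f) x.

Definition C1_on f U : Prop :=
  forall x, U x -> ediff f x /\ {for x, continuous (egrad f)}.

Definition C2_on f U : Prop :=
  forall x, U x -> [/\ ediff f x, differentiable (egrad f) x
    & {for x, continuous (hessian f)}].

Definition regular_subdiff f x : set 'rV[R]_m :=
  [set v | f x \is a fin_num /\
    forall e : R, 0 < e -> \forall x' \near x,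
      (f x + (dotv v (x' - x) - e * enorm (x' - x))%:E <= f x')%E].

Definition limiting_subdiff f x : set 'rV[R]_m :=
  [set v | f x \is a fin_num /\
    exists u w : nat -> 'rV[R]_m,
      [/\ u @ \oo --> x, (f (u n) @[n --> \oo] --> f x),
          (forall n, regular_subdiff f (u n) (w n)) & w @ \oo --> v]].

Definition dom_subdiff f : set 'rV[R]_m :=
  [set x | limiting_subdiff f x !=set0].

Definition strictly_convex_on f C : Prop :=
  forall x y (t : R), C x -> C y -> x != y -> 0 < t -> t < 1 ->
    (f (t *: x + (1 - t) *: y)%R < t%:E * f x + (1 - t)%:E * f y)%E.

Definition essentially_smooth phi : Prop :=
  [/\ (edom phi)° !=set0,
      (forall x, (edom phi)° x -> ediff phi x)
    & forall (u : nat -> 'rV[R]_m) x,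
        (forall n, (edom phi)° (u n)) -> bdry (edom phi) x ->
        u @ \oo --> x -> enorm (egrad phi (u n)) @[n --> \oo] --> +oo].

Definition essentially_strictly_convex phi : Prop :=
  forall C, convex_set (C : set (convex_lmodType 'rV[R]_m)) ->
    C `<=` dom_subdiff phi -> strictly_convex_on phi C.

Definition legendre phi : Prop :=
  essentially_smooth phi /\ essentially_strictly_convex phi.

Definition econjugate phi v : \bar R :=
  ereal_sup (range (fun x => ((dotv v x)%:E - phi x)%E)).

Definition super_coercive phi : Prop :=
  forall M : R, exists K : R, forall x, K < enorm x ->
    (M%:E < phi x * (enorm x)^-1%:E)%E.

Definition very_strictly_convex phi : Prop :=
  [/\ (edom phi)° !=set0, C2_on phi (edom phi)°
    & forall x, (edom phi)° x ->
        forall w, w != 0 -> 0 < dotv w (w *m hessian phi x)].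

Definition bregman phi x y : \bar R :=
  if `[< (edom phi)° y >]
  then (phi x - phi y - (dotv (egrad phi y) (x - y))%:E)%E
  else +oo%E.

Definition left_obj phi (lam : R) f y x : \bar R :=
  (f x + lam^-1%:E * bregman phi x y)%E.

Definition left_env phi (lam : R) f y : \bar R :=
  ereal_inf (range (left_obj phi lam f y)).

(* Usual convention: the argmin of the constant function +oo is empty. *)
Definition left_prox phi (lam : R) f y : set 'rV[R]_m :=
  [set x | left_obj phi lam f y x = left_env phi lam f y /\
           (left_env phi lam f y < +oo)%E].

Definition prox_parameters phi f : set R :=
  [set lam | 0 < lam /\
    exists2 y, (edom phi)° y & (-oo < left_env phi lam f y)%E].

Definition prox_bounded phi f : Prop := prox_parameters phi f !=set0.

Definition prox_threshold phi f : \bar R :=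
  ereal_sup [set lam%:E | lam in prox_parameters phi f].

Definition locally_lsc f x : Prop :=
  exists2 e : R, 0 < e & forall a : R, (a%:E <= f x + e%:E)%E ->
    closed [set x' | enorm (x' - x) <= e /\ (f x' <= a%:E)%E].

Definition relatively_prox_regular phi f x0 v0 : Prop :=
  [/\ f x0 \is a fin_num, locally_lsc f x0, limiting_subdiff f x0 v0
    & exists e r : R,
      [/\ 0 < e, 0 <= r,
          (forall x, enorm (x - x0) < e -> (edom phi)° x)
        & forall x' x v, enorm (x' - x0) < e -> enorm (x - x0) < e ->
            (f x - f x0 < e%:E)%E -> limiting_subdiff f x v ->
            enorm (v - v0) < e ->
            (f x + (dotv v (x' - x))%:E - r%:E * bregman phi x' x <= f x')%E]].

End ExtendedRealFunctions.

(* The library's [locally [lipschitz _ | _ in A]] localises on A `*` A, hence also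
   around off-diagonal pairs; here the usual pointwise notion is spelled out. *)
Definition locally_lipschitz {R : realType} {V W : normedModType R}
    (h : V -> W) (A : set V) : Prop :=
  forall x, A x -> exists2 U, nbhs x U & [lipschitz h y | y in U `&` A].

(* Main.v *)
Require Import Defs.
From HB Require Import structures.
From mathcomp Require Import all_boot all_order all_algebra.
From mathcomp Require Import all_classical all_reals all_analysis.
From mathcomp Require Import ring lra.

Set Implicit Arguments.
Unset Strict Implicit.
Unset Printing Implicit Defensive.

Import Order.TTheory GRing.Theory Num.Theory.
Import numFieldNormedType.Exports.

Local Open Scope classical_set_scope.
Local Open Scope ring_scope.

(** Write [G] for the gradient of [phi] and [psi := lam f + phi]. For [y] in the
    interior of the domain of [phi], expanding the Bregman distance gives
      [lam (f x + D(x, y) / lam) = psi x - <G y, x> + (<G y, y> - phi y)],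
    so the left prox at [y] is the set of minimizers of [psi] tilted by the linear
    form [w = G y], and [lam env = phi^* o G - psi^* o G]. Everything reduces to
    one general fact about a lower semicontinuous superlinear function [psi],
    convex or not: where the tilted minimizer [P w] is unique it is continuous in
    [w], and [psi^*] is differentiable with gradient [P w]
    ([exposed_continuous], [econjugate_frechet]). Applied to [phi] itself this says
    that the gradient of [phi^*] inverts [G]. The chain rule then gives
    [lam grad env = (y - P (G y)) H^T], and the Hessian [H] of [phi] is symmetric
    ([jacobian_grad_sym]).

    It remains to see that the minimizer is unique for tilts near
    [wbar = G xbar + lam vbar = G ybar]. At [wbar] itself [xbar] is the only
    minimizer for small [lam] ([penalized_exposes]): close to [xbar],
    prox-regularity at [vbar] bounds [f] from below up to [r D], which the term
    [D / lam] beats when [lam r < 1]; away from [xbar] the Bregman distance grows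
    at least linearly, whereas prox-boundedness lets [f] decrease by at most a
    multiple of a Bregman distance plus an affine function. By stability, for [w] near [wbar]
    all minimizers [q] lie close to [xbar] with [f q] hardly above [f xbar], and
    the optimality condition [(w - G q) / lam] is a subgradient of [f] at [q] close
    to [vbar]. Prox-regularity is thus available at every such [q]
    ([near_prox_regular_ineq]); comparing two minimizers for the same tilt makes
    them equal ([near_exposes]), and comparing minimizers for two tilts gives
      [(1 - lam r) <G p1 - G p2, p1 - p2> <= <w1 - w2, p1 - p2>].
    When [H] is positive definite, [G] is strongly monotone near [xbar], so [P] is
    Lipschitz ([argmin_lipschitz]); if [H] is moreover locally Lipschitz, so is the
    product in the gradient formula. *)

(** * Row vectors, Fréchet gradients and Jacobians *)

Section NearDist.
Context {R : realType} {V : normedModType R}.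

Lemma near_distP (x : V) (P : V -> Prop) :
  (\forall y \near x, P y) <->
  exists2 e : R, 0 < e & forall y, `|y - x| < e -> P y.
Proof.
split=> [/nbhs_ballP[e /= e0 xP]|[e e0 xP]].
  by exists e => // y yx; apply: xP; rewrite -ball_normE /= distrC.
apply/nbhs_ballP; exists e => //= y; rewrite -ball_normE /= distrC.
exact: xP.
Qed.

Lemma addrDBl (x z : V) : x + z - x = z.
Proof. by rewrite addrAC subrr add0r. Qed.

Lemma near_dist (x : V) (e : R) : 0 < e -> \forall y \near x, `|y - x| < e.
Proof. by move=> e0; apply/near_distP; exists e. Qed.

Lemma continuous_distP {W : normedModType R} (h : V -> W) x :
  {for x, continuous h} <->
  forall e : R, 0 < e -> \forall y \near x, `|h y - h x| < e.
Proof.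
split=> [hx e e0|hx].
  by move/cvgrPdist_lt: hx => /(_ e e0); apply: filterS => y; rewrite distrC.
by apply/cvgrPdist_lt => e e0; apply: filterS (hx e e0) => y; rewrite distrC.
Qed.

Lemma near_eq_continuous {W : normedModType R} (g h : V -> W) x :
  (\forall z \near x, g z = h z) -> {for x, continuous g} -> {for x, continuous h}.
Proof.
move=> gh /continuous_distP cg; apply/continuous_distP => e e0.
have ghx := nbhs_singleton gh.
by apply: filterS2 gh (cg e e0) => z <-; rewrite ghx.
Qed.

(** The hypothesis is what a bounded bilinear map satisfies: change one argument at a
    time. *)
Lemma bilinear_continuous {X Y Z : normedModType R} (B : X -> Y -> Z) (c : R)
    (u : V -> X) (v : V -> Y) x :
  (forall a b a' b',
    `|B a b - B a' b'| <= c * (`|a - a'| * `|b|) + c * (`|a'| * `|b - b'|)) ->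
  {for x, continuous u} -> {for x, continuous v} ->
  {for x, continuous (fun z => B (u z) (v z))}.
Proof.
move=> Bc cu cv; pose b z := c * (`|u z - u x| * `|v z|) +
  c * (`|u x| * `|v z - v x|).
have cb : {for x, continuous b}.
  have cu' : `|u z - u x| @[z --> x] --> `|u x - u x|.
    exact: cvg_norm (cvgB cu (cvg_cst _)).
  have cv' : `|v z - v x| @[z --> x] --> `|v x - v x|.
    exact: cvg_norm (cvgB cv (cvg_cst _)).
  exact: (cvgD (cvgM (cvg_cst _) (cvgM cu' (cvg_norm cv)))
    (cvgM (cvg_cst _) (cvgM (cvg_cst _) cv'))).
apply/continuous_distP => e e0.
have := (continuous_distP _ _).1 cb e e0; apply: filterS => z.
rewrite {2}/b !subrr !normr0 mul0r mulr0 !mulr0 addr0 subr0 => bz.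
exact: le_lt_trans (le_trans (Bc _ _ _ _) (ler_norm _)) bz.
Qed.

End NearDist.

Section Vectors.
Context {R : realType} {m : nat}.
Implicit Types (u v w x y g : 'rV[R]_m) (J : 'M[R]_m).

Lemma dotvE u v : dotv u v = \sum_i u 0 i * v 0 i.
Proof. by rewrite /dotv mxE; apply: eq_bigr => i _; rewrite mxE. Qed.

Lemma dotvC u v : dotv u v = dotv v u.
Proof. by rewrite !dotvE; apply: eq_bigr => i _; rewrite mulrC. Qed.

Lemma dotv_is_linear u : linear (dotv u : 'rV[R]_m -> R^o).
Proof.
move=> a v w; change (dotv u (a *: v + w) = a * dotv u v + dotv u w).
rewrite !dotvE mulr_sumr -big_split; apply: eq_bigr => i _.
by rewrite !mxE /=; ring.
Qed.

HB.instance Definition _ u :=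
  GRing.isLinear.Build R 'rV[R]_m R *:%R (dotv u) (dotv_is_linear u).

Lemma dotvDr u v w : dotv u (v + w) = dotv u v + dotv u w.
Proof. exact: linearD. Qed.

Lemma dotvBr u v w : dotv u (v - w) = dotv u v - dotv u w.
Proof. exact: linearB. Qed.

Lemma dotvNr u v : dotv u (- v) = - dotv u v.
Proof. exact: linearN. Qed.

Lemma dotvZr a u v : dotv u (a *: v) = a * dotv u v.
Proof. exact: linearZ. Qed.

Lemma dotv0r u : dotv u 0 = 0.
Proof. exact: linear0. Qed.

Lemma dotvDl u v w : dotv (v + w) u = dotv v u + dotv w u.
Proof. by rewrite ![dotv _ u]dotvC dotvDr. Qed.

Lemma dotvBl u v w : dotv (v - w) u = dotv v u - dotv w u.
Proof. by rewrite ![dotv _ u]dotvC dotvBr. Qed.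

Lemma dotvZl a u v : dotv (a *: v) u = a * dotv v u.
Proof. by rewrite ![dotv _ u]dotvC dotvZr. Qed.

Lemma dotv_mulmx u v J : dotv u (v *m J) = dotv (u *m J^T) v.
Proof. by rewrite /dotv trmx_mul mulmxA. Qed.

Lemma dotv_delta u i : dotv u (delta_mx 0 i) = u 0 i.
Proof.
rewrite dotvE (bigD1 i) //= mxE !eqxx mulr1 big1 ?addr0 // => j ji.
by rewrite mxE (negPf ji) andbF mulr0.
Qed.

Lemma dotv_delta_mx J i j : dotv (delta_mx 0 i *m J) (delta_mx 0 j) = J i j.
Proof. by rewrite dotv_delta -rowE mxE. Qed.

Lemma coord_le_norm {p q : nat} (B : 'M[R]_(p, q)) i j : `|B i j| <= `|B|.
Proof.
by rewrite {2}/Num.Def.normr /= mx_normrE; apply: (le_bigmax _ _ (i, j)).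
Qed.

Lemma norm_le_coord {p q : nat} (B : 'M[R]_(p, q)) (c : R) :
  0 <= c -> (forall i j, `|B i j| <= c) -> `|B| <= c.
Proof.
move=> c0 Bc; rewrite /Num.Def.normr /= mx_normrE.
by apply: bigmax_le => // -[i j] _; exact: Bc.
Qed.

(** Compares the bilinear operations and the Euclidean norm with the max norm; the
    successor keeps it positive in dimension 0. *)
Definition dimc : R := m.+1%:R.

Lemma dimc_gt0 : 0 < dimc.
Proof. by rewrite ltr0Sn. Qed.

Lemma dimc_ge1 : 1 <= dimc.
Proof. by rewrite ler1n. Qed.

Lemma sum_le_dimc (F : 'I_m -> R) (c : R) :
  0 <= c -> (forall i, `|F i| <= c) -> `|\sum_i F i| <= dimc * c.
Proof.
move=> c0 Fc; apply: (le_trans (ler_norm_sum _ _ _)).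
apply: (le_trans (ler_sum _ (fun i _ => Fc i))).
rewrite sumr_const card_ord -[c *+ m]mulr_natl ler_wpM2r // ler_nat.
exact: leqnSn.
Qed.

Lemma dotv_bound u v : `|dotv u v| <= dimc * (`|u| * `|v|).
Proof.
rewrite dotvE; apply: sum_le_dimc => [|i]; first by rewrite mulr_ge0.
by rewrite normrM ler_pM // coord_le_norm.
Qed.

Lemma dotv_le u v : dotv u v <= dimc * (`|u| * `|v|).
Proof. exact: le_trans (ler_norm _) (dotv_bound u v). Qed.

Lemma mulmx_bound u J : `|u *m J| <= dimc * (`|u| * `|J|).
Proof.
apply: norm_le_coord => [|i j].
  by rewrite !mulr_ge0 // ltW // dimc_gt0.
rewrite mxE; apply: sum_le_dimc => [|k]; first by rewrite mulr_ge0.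
by rewrite normrM ler_pM // coord_le_norm.
Qed.

Lemma mulmx_dist u v (A B : 'M[R]_m) :
  `|u *m A - v *m B| <= dimc * (`|u - v| * `|A|) + dimc * (`|v| * `|A - B|).
Proof.
have -> : u *m A - v *m B = (u - v) *m A + v *m (A - B).
  by rewrite mulmxBl mulmxBr addrA subrK.
by apply: (le_trans (ler_normD _ _)); rewrite lerD // mulmx_bound.
Qed.

Lemma dotv_dist u v w x :
  `|dotv u v - dotv w x| <= dimc * (`|u - w| * `|v|) + dimc * (`|w| * `|v - x|).
Proof.
have -> : dotv u v - dotv w x = dotv (u - w) v + dotv w (v - x).
  by rewrite dotvBl dotvBr addrA subrK.
by apply: (le_trans (ler_normD _ _)); rewrite lerD // dotv_bound.
Qed.

Lemma mulmx_continuous (u : 'rV[R]_m -> 'rV[R]_m) (A : 'rV[R]_m -> 'M[R]_m) x :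
  {for x, continuous u} -> {for x, continuous A} ->
  {for x, continuous (fun z => u z *m A z)}.
Proof. by apply: bilinear_continuous => *; exact: mulmx_dist. Qed.

Lemma dotv_continuous2 (u v : 'rV[R]_m -> 'rV[R]_m) x :
  {for x, continuous u} -> {for x, continuous v} ->
  {for x, continuous (fun z => dotv (u z) (v z))}.
Proof. by apply: bilinear_continuous => *; exact: dotv_dist. Qed.

Lemma dotvv_ge0 u : 0 <= dotv u u.
Proof. by rewrite dotvE sumr_ge0 // => i _; rewrite -expr2 sqr_ge0. Qed.

Lemma norm_le_enorm u : `|u| <= enorm u.
Proof.
apply: norm_le_coord => [|i j]; first by rewrite sqrtr_ge0.
rewrite -[`|_|]sqrtr_sqr /enorm ler_sqrt ?dotvv_ge0 //.
rewrite dotvE (bigD1 j) //= ord1 expr2 lerDl sumr_ge0 // => k _.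
by rewrite -expr2 sqr_ge0.
Qed.

Lemma enorm_le_norm u : enorm u <= dimc * `|u|.
Proof.
have c0 : 0 <= dimc * `|u| by rewrite mulr_ge0 // ltW // dimc_gt0.
rewrite -[leRHS]ger0_norm // -sqrtr_sqr /enorm ler_sqrt ?sqr_ge0 //.
apply: (le_trans (dotv_le u u)); rewrite exprMn -expr2 ler_wpM2r ?sqr_ge0 //.
by rewrite expr2 ler_peMl ?dimc_ge1 // ltW // dimc_gt0.
Qed.

Lemma dotv_continuous u : continuous (dotv u).
Proof.
have [M M0 uM] : exists2 M, 0 < M & forall v, `|dotv u v| <= M * `|v|.
  exists (dimc * (`|u| + 1)).
    by rewrite mulr_gt0 ?dimc_gt0 // ltr_wpDl.
  move=> v; apply: (le_trans (dotv_bound u v)).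
  by rewrite mulrA ler_wpM2r // ler_pM2l ?dimc_gt0 // lerDl.
move=> x; apply/continuous_distP => e e0.
have : \forall y \near x, `|y - x| < e / M by apply: near_dist; rewrite divr_gt0.
apply: filterS => y yx; rewrite -dotvBr; apply: le_lt_trans (uM _) _.
by rewrite mulrC -ltr_pdivlMr.
Qed.

End Vectors.
Arguments dimc {R} m.


Section Frechet.
Context {R : realType} {m : nat}.
Implicit Types (u v w x y g : 'rV[R]_m) (J : 'M[R]_m) (h : 'rV[R]_m -> R).

(** An epsilon form of differentiability that carries its gradient, so that gradients
    can be computed without going through partial derivatives. *)
Definition frechet h x g : Prop :=
  forall e : R, 0 < e ->
    \forall y \near x, `|h y - h x - dotv g (y - x)| <= e * `|y - x|.

Lemma differentiable_bound {W : normedModType R} (F : 'rV[R]_m -> W) x :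
  differentiable F x ->
  forall e : R, 0 < e ->
    \forall y \near x, `|F y - F x - 'd F x (y - x)| <= e * `|y - x|.
Proof.
move=> /diff_locally /eqaddoP Fx e /Fx; rewrite -nbhs_nearE => /near_distP[d d0 dP].
apply/near_distP; exists d => // y yx.
have := dP (y - x); rewrite subr0 => /(_ yx).
by rewrite -[X in `|X|]/(F (y - x + x) - (F x + 'd F x (y - x)))
  subrK opprD addrA.
Qed.

Lemma frechet_diff h x g : frechet h x g -> differentiable h x /\ grad h x = g.
Proof.
move=> hg.
have hx : h \o shift x = cst (h x) + dotv g +o_ (0 : 'rV[R]_m) id.
  apply/eqaddoP => e e0.
  have [d d0 dP] := (near_distP _ _).1 (hg e e0).
  apply/(near_distP (0 : 'rV[R]_m)); exists d => // z; rewrite subr0 => zd.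
  have := dP (z + x); rewrite addrK => /(_ zd).
  by rewrite -[X in _ -> is_true (`|X| <= _)]/(h (z + x) - (h x + dotv g z)) opprD addrA.
have dE := diff_unique (@dotv_continuous R m g) hx.
have dh : differentiable h x.
  apply/diff_locallyP; rewrite dE; split=> //; exact: dotv_continuous.
split=> //; apply/rowP => i; rewrite mxE deriveE // dE.
exact: dotv_delta.
Qed.

Lemma diff_grad h x v : differentiable h x -> 'd h x v = dotv (grad h x) v.
Proof.
move=> dh; rewrite [in LHS](row_sum_delta v) linear_sum dotvE.
by apply: eq_bigr => i _; rewrite linearZ /= -deriveE // mxE mulrC.
Qed.

Lemma diff_frechet h x : differentiable h x -> frechet h x (grad h x).
Proof.
move=> dh e e0; apply: filterS (differentiable_bound dh e0) => y.
by rewrite diff_grad.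
Qed.

Lemma frechet_near_eq h1 h2 x g :
  (\forall y \near x, h1 y = h2 y) -> frechet h1 x g -> frechet h2 x g.
Proof.
move=> h12 h1g e e0; have h12x := nbhs_singleton h12.
by apply: filterS2 h12 (h1g e e0) => y <-; rewrite h12x.
Qed.

(** The gradient of a composite is the transposed Jacobian applied to the outer
    gradient; with row vectors the Jacobian multiplies on the right. *)
Lemma frechet_comp h (F : 'rV[R]_m -> 'rV[R]_m) x g :
  frechet h (F x) g -> differentiable F x ->
  frechet (h \o F) x (g *m (jacobian F x)^T).
Proof.
move=> /frechet_diff[dh gE] dF.
have dhF : differentiable (h \o F) x by exact: differentiable_comp.
suff <- : grad (h \o F) x = g *m (jacobian F x)^T by exact: diff_frechet.
apply/rowP => i; rewrite mxE deriveE // diff_comp //= diff_grad // gE.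
by rewrite -deriveE // deriveEjacobian // dotv_mulmx dotv_delta.
Qed.

Lemma frechetB h1 h2 x g1 g2 :
  frechet h1 x g1 -> frechet h2 x g2 -> frechet (h1 - h2) x (g1 - g2).
Proof.
move=> h1g h2g e e0; have e20 : 0 < e / 2 by rewrite divr_gt0.
apply: filterS2 (h1g _ e20) (h2g _ e20) => y H1 H2.
have -> : (h1 - h2) y - (h1 - h2) x - dotv (g1 - g2) (y - x) =
  (h1 y - h1 x - dotv g1 (y - x)) - (h2 y - h2 x - dotv g2 (y - x)).
  rewrite dotvBl; change ((h1 y - h2 y) - (h1 x - h2 x) -
    (dotv g1 (y - x) - dotv g2 (y - x)) =
    (h1 y - h1 x - dotv g1 (y - x)) - (h2 y - h2 x - dotv g2 (y - x))).
  by ring.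
by apply: (le_trans (ler_normB _ _)); lra.
Qed.

Lemma frechetZ a h x g : frechet h x g -> frechet (a *: h) x (a *: g).
Proof.
move=> /frechet_diff[dh <-].
have dah : differentiable (a *: h) x by exact: differentiableZ.
suff <- : grad (a *: h) x = a *: grad h x by exact: diff_frechet.
apply/rowP => i; rewrite !mxE deriveE // diffZ //= -deriveE //.
Qed.

Lemma is_derive_line {W : normedModType R} (F : 'rV[R]_m -> W) x v (t : R) :
  differentiable F (x + t *: v) ->
  is_derive t 1 (fun s : R => F (x + s *: v)) ('d F (x + t *: v) v).
Proof.
move=> dF; pose l := fun s : R => x + s *: v.
have dl : is_diff t l ( *:%R ^~ v).
  rewrite (_ : ( *:%R ^~ v) = 0 + ( *:%R ^~ v)); last by rewrite add0r.
  exact: is_diffD.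
have dFl : differentiable (F \o l) t by exact: differentiable_comp.
apply: DeriveDef; first exact: diff_derivable.
rewrite deriveE // diff_comp //=; congr ('d F _ _).
by rewrite diff_val scale1r.
Qed.

Lemma MVT_line h x v :
  (forall t : R, 0 <= t <= 1 -> differentiable h (x + t *: v)) ->
  exists2 t : R, 0 < t < 1 & h (x + v) - h x = dotv (grad h (x + t *: v)) v.
Proof.
move=> dh.
have dl (t : R) : 0 <= t <= 1 ->
    is_derive t 1 (fun s : R => h (x + s *: v)) (dotv (grad h (x + t *: v)) v).
  by move=> /dh dht; rewrite -diff_grad //; exact: is_derive_line.
have [||t] := @MVT R (fun s : R => h (x + s *: v))
    (fun s => dotv (grad h (x + s *: v)) v) 0 1 ltr01.
- by move=> t; rewrite in_itv /= => /andP[t0 t1]; apply: dl; rewrite !ltW.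
- apply: derivable_within_continuous => t; rewrite in_itv /= => t01.
  by have [] := dl t t01.
rewrite in_itv /= => t01 E; exists t => //.
by move: E; rewrite scale1r scale0r addr0 subr0 mulr1.
Qed.

Lemma frechet_shift h x a g :
  frechet h (x + a) g -> frechet (fun y => h (y + a)) x g.
Proof.
move=> hg e e0; have [d d0 dP] := (near_distP _ _).1 (hg e e0).
apply/near_distP; exists d => // y yx.
by have := dP (y + a); rewrite opprD addrACA subrr addr0 => /(_ yx).
Qed.

(** The mean value theorem applied to [y |-> h (y + t u) - h y] along [t v] turns the
    second difference into [t] times a difference of gradients, which differentiability
    of the gradient at [x] evaluates up to [o(t ^ 2)]. *)
Lemma second_difference h x u v :
  (\forall y \near x, differentiable h y) -> differentiable (grad h) x ->
  forall e : R, 0 < e -> exists2 d : R, 0 < d & forall t : R, 0 < t < d ->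
    `|(h (x + t *: v + t *: u) - h (x + t *: v)) - (h (x + t *: u) - h x)
      - t ^+ 2 * dotv (u *m jacobian (grad h) x) v| <= e * t ^+ 2.
Proof.
move=> /near_distP[d1 d10 dh] dG e e0.
set G := grad h in dG *; set J := jacobian G x.
pose c : R := `|u| + `|v| + 1.
have c1 : 1 <= c by rewrite lerDr addr_ge0.
have c0 : 0 < c by exact: lt_le_trans ltr01 c1.
pose e' := e / (2 * dimc m * c ^+ 2).
have K0 : 0 < 2 * dimc m * c ^+ 2 by rewrite !mulr_gt0 ?dimc_gt0 ?exprn_gt0.
have e'0 : 0 < e' by rewrite divr_gt0.
have [d2 d20 GJ] := (near_distP _ _).1 (differentiable_bound dG e'0).
exists (Num.min d1 d2 / c) => [|t /andP[t0 td]].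
  by rewrite divr_gt0 // lt_min d10.
have tc : t * c < Num.min d1 d2 by rewrite -ltr_pdivlMr.
have [tc1 tc2] : t * c < d1 /\ t * c < d2 by move: tc; rewrite lt_min => /andP.
have small (a b : R) : 0 <= a <= 1 -> 0 <= b <= 1 ->
    `|a *: (t *: v) + b *: (t *: u)| <= t * c.
  move=> /andP[a0 a1] /andP[b0 b1]; apply: (le_trans (ler_normD _ _)).
  rewrite !normrZ !(ger0_norm a0, ger0_norm b0) gtr0_norm //.
  rewrite /c !mulrDr mulr1.
  have : a * (t * `|v|) <= t * `|v| by rewrite ler_piMl // mulr_ge0 // ltW.
  have : b * (t * `|u|) <= t * `|u| by rewrite ler_piMl // mulr_ge0 // ltW.
  lra.
pose k := (fun y => h (y + t *: u)) - h.
have kG (a : R) : 0 <= a <= 1 ->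
    frechet k (x + a *: (t *: v))
      (G (x + a *: (t *: v) + t *: u) - G (x + a *: (t *: v))).
  move=> a01; apply: frechetB.
    apply: frechet_shift; apply: diff_frechet; apply: dh.
    rewrite -[X in X - x]addrA addrDBl; apply: le_lt_trans tc1.
    by have := small a 1 a01; rewrite ler01 lexx scale1r => ->.
  apply: diff_frechet; apply: dh.
  rewrite addrDBl; apply: le_lt_trans tc1.
  by have := small a 0 a01; rewrite ler01 lexx scale0r addr0 => ->.
have [|a /andP[a0 a1]] := @MVT_line k x (t *: v).
  by move=> a /kG /frechet_diff[].
have a01 : 0 <= a <= 1 by rewrite !ltW.
have [_ ->] := frechet_diff (kG a a01).
rewrite -[k _ - k _]/(h (x + t *: v + t *: u) - h (x + t *: v)
  - (h (x + t *: u) - h x)) => ->.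
set z1 := a *: (t *: v) + t *: u; set z2 := a *: (t *: v).
have nz1 : `|z1| <= t * c.
  by have := small a 1 a01; rewrite ler01 lexx scale1r => ->.
have nz2 : `|z2| <= t * c.
  by have := small a 0 a01; rewrite ler01 lexx scale0r addr0 => ->.
have GJz z : `|z| <= t * c -> `|G (x + z) - G x - z *m J| <= e' * (t * c).
  move=> zt; have := GJ (x + z); rewrite addrDBl => /(_ (le_lt_trans zt tc2)).
  rewrite /J /jacobian mul_rV_lin1 => H; apply: (le_trans H).
  by rewrite ler_pM2l.
rewrite -addrA -/z1 dotvZr expr2 -mulrA -mulrBr.
have -> : t * dotv (u *m J) v = dotv (t *: u *m J) v.
  by rewrite -scalemxAl dotvZl.
rewrite -dotvBl normrM gtr0_norm //.
have -> : t *: u = z1 - z2 by rewrite /z1 addrDBl.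
have -> : G (x + z1) - G (x + z2) - (z1 - z2) *m J =
    (G (x + z1) - G x - z1 *m J) - (G (x + z2) - G x - z2 *m J).
  rewrite mulmxBl; move: (G (x + z1)) (G (x + z2)) (G x) => p q r.
  move: (z1 *m J) (z2 *m J) => a1J a2J.
  by apply/rowP => i; rewrite !mxE; ring.
have tt : t * (e * t) = t * (2 * dimc m * c * (e' * (t * c))).
  by rewrite /e'; field; rewrite !gt_eqF ?dimc_gt0.
rewrite [e * _]mulrCA tt ler_pM2l //.
apply: (le_trans (dotv_bound _ _)).
have nn : `|(G (x + z1) - G x - z1 *m J) - (G (x + z2) - G x - z2 *m J)|
    <= 2 * (e' * (t * c)).
  by apply: (le_trans (ler_normB _ _)); have := GJz _ nz1; have := GJz _ nz2; lra.
have vc : `|v| <= c by rewrite /c; have := normr_ge0 u; lra.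
have -> : 2 * dimc m * c * (e' * (t * c)) = dimc m * (2 * (e' * (t * c)) * c).
  by ring.
by rewrite ler_pM2l ?dimc_gt0 // ler_pM.
Qed.

(** The second difference is symmetric in the two directions, hence so is its limit.
    Mere differentiability of the gradient at the point is enough for this argument. *)
Lemma jacobian_grad_sym h x :
  (\forall y \near x, differentiable h y) -> differentiable (grad h) x ->
  (jacobian (grad h) x)^T = jacobian (grad h) x.
Proof.
move=> dh dG; set J := jacobian _ _.
suff sym u v : dotv (u *m J) v = dotv (v *m J) u.
  apply/matrixP => i j; rewrite mxE -(dotv_delta_mx J j i) -(dotv_delta_mx J i j).
  exact: sym.
apply/eqP; rewrite -subr_eq0 -normr_eq0 eq_le normr_ge0 andbT.
apply/ler_addgt0Pl => e e0; rewrite addr0.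
have e20 : 0 < e / 2 by rewrite divr_gt0.
have [d1 d10 D1] := second_difference u v dh dG e20.
have [d2 d20 D2] := second_difference v u dh dG e20.
pose t := Num.min d1 d2 / 2.
have m0 : 0 < Num.min d1 d2 by rewrite lt_min d10.
have t0 : 0 < t by rewrite divr_gt0.
have tm : t < Num.min d1 d2 by rewrite /t; lra.
have /andP[td1 td2] : (t < d1) && (t < d2) by rewrite -lt_min.
have := D1 t; rewrite t0 td1 => /(_ isT).
have := D2 t; rewrite t0 td2 => /(_ isT).
rewrite -!/J [x + t *: u + t *: v]addrAC => H2 H1.
rewrite -(ler_pM2r (exprn_gt0 2 t0)) -[t ^+ 2 in leLHS]gtr0_norm ?exprn_gt0 //.
rewrite -normrM.
set a := dotv _ v in H1 *; set b := dotv _ u in H2 *.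
set p := h (x + t *: v + t *: u) in H1 H2; set q := h (x + t *: v) in H1 H2.
set r := h (x + t *: u) in H1 H2.
have -> : (a - b) * t ^+ 2 = (p - r - (q - h x) - t ^+ 2 * b)
  - (p - q - (r - h x) - t ^+ 2 * a) by ring.
by apply: (le_trans (ler_normB _ _)); lra.
Qed.

Lemma MVT_dotv (F : 'rV[R]_m -> 'rV[R]_m) u x v :
  (forall t : R, 0 <= t <= 1 -> differentiable F (x + t *: v)) ->
  exists2 t : R, 0 < t < 1 &
    dotv u (F (x + v) - F x) = dotv u (v *m jacobian F (x + t *: v)).
Proof.
move=> dF; pose h y := dotv u (F y).
have hF t : 0 <= t <= 1 ->
    frechet h (x + t *: v) (u *m (jacobian F (x + t *: v))^T).
  move=> t01; apply: (@frechet_comp (dotv u)); last exact: dF.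
  move=> e e0; apply/near_distP; exists 1 => // y _.
  by rewrite dotvBr subrr normr0 mulr_ge0 // ltW.
have [|t t01 E] := @MVT_line h x v.
  by move=> t /hF /frechet_diff[].
exists t => //; rewrite dotvBr dotv_mulmx -[LHS]/(h (x + v) - h x) E.
have /hF/frechet_diff[_ ->] // : 0 <= t <= 1.
by move: t01 => /andP[? ?]; rewrite !ltW.
Qed.

Lemma ball_segment x y z (d t : R) : `|y - x| < d -> `|z - x| < d ->
  0 <= t <= 1 -> `|z + t *: (y - z) - x| < d.
Proof.
move=> yx zx.
move=> /andP[t0 t1].
have -> : z + t *: (y - z) - x = t *: (y - x) + (1 - t) *: (z - x).
  by apply/rowP => i; rewrite !mxE; ring.
apply: (le_lt_trans (ler_normD _ _)); rewrite !normrZ ger0_norm //.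
rewrite [`|1 - t|]ger0_norm ?subr_ge0 //.
have [->|tn0] := eqVneq t 0; first by rewrite mul0r add0r subr0 mul1r.
have tp : 0 < t by rewrite lt_neqAle eq_sym tn0.
have A : t * `|y - x| < t * d by rewrite ltr_pM2l.
have B : (1 - t) * `|z - x| <= (1 - t) * d.
  by rewrite ler_wpM2l ?subr_ge0 // ltW.
lra.
Qed.

Lemma jacobian_lipschitz (F : 'rV[R]_m -> 'rV[R]_m) (d M : R) x :
  (forall y, `|y - x| < d -> differentiable F y) ->
  (forall y, `|y - x| < d -> `|jacobian F y| <= M) ->
  forall y z, `|y - x| < d -> `|z - x| < d -> `|F y - F z| <= dimc m * M * `|y - z|.
Proof.
move=> dF JM y z yx zx.
have seg (t : R) := ball_segment (t := t) yx zx.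
have M0 : 0 <= M by apply: le_trans (JM y yx).
apply: norm_le_coord => [|i j]; first by rewrite !mulr_ge0 // ltW // dimc_gt0.
have [t t01] := @MVT_dotv F (delta_mx 0 j) z (y - z) (fun t ht => dF _ (seg t ht)).
have t01' : 0 <= t <= 1 by move: t01 => /andP[? ?]; rewrite !ltW.
rewrite [z + (y - z)]addrC subrK !(dotvC (delta_mx _ _)) !dotv_delta ord1 => ->.
apply: (le_trans (coord_le_norm _ _ _)); apply: (le_trans (mulmx_bound _ _)).
rewrite -mulrA ler_pM2l ?dimc_gt0 // mulrC ler_wpM2r //; exact/JM/seg.
Qed.

(** By homogeneity the constant is the minimum over the unit sphere, which is compact;
    the sphere is empty in dimension 0. *)
Lemma quadratic_form_coercive (A : 'M[R]_m) :
  (forall w, w != 0 -> 0 < dotv w (w *m A)) ->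
  exists2 c : R, 0 < c & forall w, c * `|w| ^+ 2 <= dotv w (w *m A).
Proof.
move=> Apos; pose S := [set w : 'rV[R]_m | `|w| = 1].
have qc : continuous (fun w : 'rV[R]_m => dotv w (w *m A)).
  move=> w; have cid : {for w, continuous (@idfun 'rV[R]_m)} by move=> U.
  have cA : {for w, continuous (fun _ : 'rV[R]_m => A)}.
    exact: (@cst_continuous _ _ A).
  exact: (dotv_continuous2 cid (mulmx_continuous cid cA)).
have cS : compact S.
  apply: bounded_closed_compact.
    by exists 1; split=> // M M1 w /= ->; exact: ltW.
  apply: (@closed_comp _ _ (fun x : 'rV[R]_m => `|x|) [set r : R | r = 1]).
    by move=> w _; exact: norm_continuous.
  exact: closed_eq.
have [S0|/nonemptyPn S0] := pselect (S !=set0); last first.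
  exists 1 => // w; have [->|wn0] := eqVneq w 0.
    by rewrite normr0 expr0n mulr0 mul0mx dotv0r.
  have : S (`|w|^-1 *: w).
    by rewrite /S /= normrZ normfV normr_id mulVf // normr_eq0.
  by rewrite S0.
have [w0 /set_mem w0S wmin] := EVT_min_rV S0 cS (continuous_subspaceT qc).
have w0n : w0 != 0 by rewrite -normr_eq0 w0S oner_eq0.
exists (dotv w0 (w0 *m A)) => [|w]; first exact: Apos.
have [->|wn0] := eqVneq w 0.
  by rewrite normr0 expr0n mulr0 mul0mx dotv0r.
have n0 : 0 < `|w| by rewrite normr_gt0.
have : (`|w|^-1 *: w) \in S.
  by apply/mem_set; rewrite /S /= normrZ normfV normr_id mulVf // normr_eq0.
move=> /wmin; rewrite -scalemxAl dotvZl dotvZr mulrA -invfM -expr2.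
by rewrite [_^-1 * _]mulrC ler_pdivlMr ?exprn_gt0.
Qed.

(** The mean value theorem writes the left-hand side of monotonicity as the quadratic
    form of the Jacobian at an intermediate point, a small perturbation of the coercive
    form at [x]. *)
Lemma strong_monotone (F : 'rV[R]_m -> 'rV[R]_m) x :
  (\forall y \near x, differentiable F y) -> {for x, continuous (jacobian F)} ->
  (forall w, w != 0 -> 0 < dotv w (w *m jacobian F x)) ->
  exists c d : R, [/\ 0 < c, 0 < d & forall y z, `|y - x| < d -> `|z - x| < d ->
    c * `|y - z| ^+ 2 <= dotv (F y - F z) (y - z)].
Proof.
move=> /near_distP[d1 d10 dF] cJ /quadratic_form_coercive[c c0 cP].
have k0 : 0 < dimc m * dimc m :> R by rewrite mulr_gt0 // dimc_gt0.
have e0 : 0 < c / 2 / (dimc m * dimc m) by rewrite !divr_gt0.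
have [d2 d20 JP] := (near_distP _ _).1 ((continuous_distP _ _).1 cJ _ e0).
exists (c / 2), (Num.min d1 d2); split.
- by rewrite divr_gt0.
- by rewrite lt_min d10.
move=> y z yx zx; set v := y - z.
have seg (t : R) : 0 <= t <= 1 -> `|z + t *: v - x| < Num.min d1 d2.
  exact: ball_segment.
have segd t : 0 <= t <= 1 -> differentiable F (z + t *: v).
  by move=> /seg; rewrite lt_min => /andP[/dF].
have [t /andP[t0 t1]] := @MVT_dotv F v z v segd.
have -> : z + v = y by rewrite /v addrC subrK.
rewrite dotvC => ->.
have t01 : 0 <= t <= 1 by rewrite !ltW.
have := seg t t01; rewrite lt_min => /andP[_ /JP Jt].
set B := jacobian F (z + t *: v) in Jt *; set A := jacobian F x in cP Jt *.
have -> : v *m B = v *m A + v *m (B - A) by rewrite -mulmxDr addrC subrK.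
rewrite dotvDr.
have H : `|dotv v (v *m (B - A))| <= c / 2 * `|v| ^+ 2.
  apply: (le_trans (dotv_bound _ _)).
  apply: (@le_trans _ _ (dimc m * (`|v| * (dimc m * (`|v| * `|B - A|))))).
    by rewrite ler_pM2l ?dimc_gt0 // ler_wpM2l // mulmx_bound.
  rewrite [leLHS](_ : _ = (`|B - A| * (dimc m * dimc m)) * `|v| ^+ 2); last by ring.
  by rewrite ler_wpM2r ?sqr_ge0 // -ler_pdivlMr // ltW.
have := cP v; move: H; rewrite ler_norml => /andP[H _]; move: H.
move: (dotv v (v *m A)) (dotv v (v *m (B - A))) (`|v| ^+ 2) => a b n; lra.
Qed.

End Frechet.

(** * Minimizers of linearly tilted superlinear functions *)

Section TiltedMinimization.
Context {R : realType} {m : nat}.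
Implicit Types (psi : 'rV[R]_m -> \bar R) (p q u v w x y : 'rV[R]_m).

Lemma gtNy_cases (a : \bar R) : (-oo < a)%E -> a = +oo%E \/ exists r, a = r%:E.
Proof. by case: a => [r _||//]; [right; exists r|left]. Qed.

(** A form of super-coercivity that also bounds the function from below, and that is
    stable under adding linear functions. *)
Definition superlinear psi : Prop :=
  forall M : R, exists B : R, forall x, ((M * `|x| - B)%:E <= psi x)%E.

Definition tiltable psi : Prop :=
  [/\ (forall x, -oo < psi x)%E, (exists x, psi x < +oo)%E,
      lower_semicontinuous psi & superlinear psi].

(** Equivalently, [p] minimizes [psi - <w, .>]; the subgradient form avoids any
    subtraction of infinite values. *)
Definition global_subgrad psi p w : Prop :=
  psi p \is a fin_num /\
  forall x, ((fine (psi p) + dotv w (x - p))%:E <= psi x)%E.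

Definition exposes psi w p : Prop :=
  global_subgrad psi p w /\ forall q, global_subgrad psi q w -> q = p.

Lemma closed_ball_compact (c : R) : compact [set x : 'rV[R]_m | `|x| <= c].
Proof.
apply: bounded_closed_compact.
  by exists c; split; [exact: num_real|move=> M cM x /= /le_trans]; apply; exact: ltW.
apply: (@closed_comp _ _ (fun x : 'rV[R]_m => `|x|) [set r : R | r <= c]).
  by move=> x _; exact: norm_continuous.
exact: closed_le.
Qed.

(** The sublevel sets above the infimum generate a filter containing a compact ball; a
    cluster point of it is a minimizer by lower semicontinuity. *)
Lemma argmin_exists psi : tiltable psi ->
  exists2 p, psi p \is a fin_num & forall x, (psi p <= psi x)%E.
Proof.
move=> [psiNy [x0 x0y] lsc sup].
have [B0 B0P] := sup 0; have [B1 B1P] := sup 1.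
have low x : ((- B0)%:E <= psi x)%E by have := B0P x; rewrite mul0r add0r.
set I := ereal_inf (range psi).
have Ilow : ((- B0)%:E <= I)%E by apply: le_ereal_inf_tmp => _ [x _ <-].
have Ile x : (I <= psi x)%E by apply: ereal_inf_lbound; exists x.
have Ifin : I \is a fin_num.
  by rewrite fin_real // (lt_le_trans _ Ilow) ?ltNyr //= (le_lt_trans (Ile x0)).
pose D := [set a : R | (I < a%:E)%E].
pose S (a : R) := [set x | (psi x < a%:E)%E].
have FF : Filter (filter_from D S).
  apply: filter_from_filter => [|a b Da Db].
    by exists (fine I + 1); rewrite /D /= -[I in (I < _)%E]fineK // lte_fin ltrDl.
  exists (Num.min a b).
    by rewrite /D /= EFin_min lt_min; apply/andP.
  by move=> x; rewrite /S /= EFin_min lt_min => /andP[].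
have PF : ProperFilter (filter_from D S).
  by apply: filter_from_proper => a /ereal_inf_lt[_ [x _ <-] xa]; exists x.
pose a0 := fine I + 1.
have Da0 : D a0 by rewrite /D /= /a0 -[I in (I < _)%E]fineK // lte_fin ltrDl.
have [|p [_ pcl]] := @closed_ball_compact (a0 + B1) (filter_from D S) PF.
  exists a0 => // x /= xa0; have := le_lt_trans (B1P x) xa0.
  by rewrite lte_fin mul1r ltrBlDr => /ltW.
have pI : (psi p <= I)%E.
  rewrite leNgt; apply/negP => Ip.
  have [a /andP[Ia ap]] : exists a : R, (I < a%:E < psi p)%E.
    have [py|[r pr]] := gtNy_cases (psiNy p).
      by exists a0; rewrite Da0 py ltry.
    exists ((fine I + r) / 2); rewrite pr -[I]fineK // !lte_fin.
    by move: Ip; rewrite pr -[I]fineK // lte_fin => Ir; apply/andP; split; lra.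
  have [V Vp Va] := lsc p a ap.
  have [|x [xa /Va]] := pcl (S a) V _ Vp; first by exists a.
  by rewrite ltNge (ltW xa).
exists p.
  by rewrite (_ : psi p = I) //; apply/eqP; rewrite eq_le pI Ile.
by move=> x; exact: le_trans pI (Ile x).
Qed.

Lemma tilt_bound psi w p : superlinear psi ->
  exists B : R, forall x, ((`|x - p| - B)%:E <= psi x - (dotv w x)%:E)%E.
Proof.
move=> /(_ (1 + dimc m * `|w|))[B BP]; exists (B + `|p|) => x.
rewrite leeBrDr // -EFinD; apply: le_trans (BP x).
rewrite lee_fin mulrDl mul1r.
have := ler_normB x p; have := dotv_le w x; lra.
Qed.

Lemma tiltable_tilt psi w :
  tiltable psi -> tiltable (fun x => psi x - (dotv w x)%:E)%E.
Proof.
move=> [psiNy [x0 x0y] lsc sup]; split.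
- by move=> x; rewrite lteBrDr // ?addNye.
- by exists x0; rewrite lteBlDr // ?addye.
- move=> x a; rewrite lteBrDr // => ax.
  have [b ab bx] : exists2 b : R, a + dotv w x < b & (b%:E < psi x)%E.
    have [py|[r pr]] := gtNy_cases (psiNy x).
      by exists (a + dotv w x + 1); rewrite ?ltrDl // py ltry.
    exists ((a + dotv w x + r) / 2); move: ax; rewrite pr -EFinD !lte_fin; lra.
  have [V Vx Vb] := lsc x b bx.
  have e0 : 0 < b - (a + dotv w x) by rewrite subr_gt0.
  have [d d0 dP] := (near_distP _ _).1
    ((continuous_distP _ _).1 (@dotv_continuous R m w x) _ e0).
  exists (V `&` [set y | `|y - x| < d]).
    by apply: filterI => //; exact: (near_dist x d0).
  move=> y [/Vb yb /dP wy]; rewrite lteBrDr //; apply: le_lt_trans yb.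
  rewrite -EFinD lee_fin; have := ler_norm (dotv w y - dotv w x); lra.
- move=> M; have [B BP] := sup (M + dimc m * `|w|); exists B => x.
  rewrite leeBrDr // -EFinD; apply: le_trans (BP x).
  rewrite lee_fin mulrDl; have := dotv_le w x; lra.
Qed.

Lemma global_subgrad_exists psi w : tiltable psi -> exists p, global_subgrad psi p w.
Proof.
move=> /(tiltable_tilt w)/argmin_exists[p]; rewrite fin_numB => /andP[pfin _] pmin.
exists p; split=> // x; have := pmin x.
rewrite leeBrDr // => /(le_trans _); apply.
by rewrite -[psi p in leRHS]fineK // -EFinB -EFinD lee_fin dotvBr; lra.
Qed.

Lemma global_subgrad_fine psi p w x : global_subgrad psi p w ->
  psi x \is a fin_num -> fine (psi p) + dotv w (x - p) <= fine (psi x).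
Proof. by move=> [_ /(_ x)] + /fineK E; rewrite -{1}E lee_fin. Qed.

(** Uniqueness of the minimizer gives a positive gap away from it, and superlinearity
    upgrades the gap to linear growth. This one estimate yields both the stability of
    minimizers and the lower bound on the Bregman distance. *)
Lemma exposed_growth psi w p (e : R) : tiltable psi -> exposes psi w p -> 0 < e ->
  exists2 c : R, 0 < c & forall x, e <= `|x - p| ->
    ((fine (psi p) + dotv w (x - p) + c * `|x - p|)%:E <= psi x)%E.
Proof.
move=> psiT [pw uniq] e0; have [psiNy _ _ sup] := psiT.
have [tNy _ tlsc tsup] := tiltable_tilt w psiT.
have [pfin pmin] := pw.
pose h x := if `|x - p| < e then +oo%E else (psi x - (dotv w x)%:E)%E.
have hE x : e <= `|x - p| -> h x = (psi x - (dotv w x)%:E)%E.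
  by rewrite /h leNgt => /negbTE ->.
have [B0 B0P] := tilt_bound w p sup.
(* On the complement of the ball the tilted function has a minimizer, whose
   value exceeds the global minimum by a gap delta. *)
have [delta delta0 gap] : exists2 delta : R, 0 < delta & forall x, e <= `|x - p| ->
    ((fine (psi p) + dotv w (x - p) + delta)%:E <= psi x)%E.
  have [[x1 [ex1 x1y]]|no] :=
      pselect (exists x, e <= `|x - p| /\ (psi x < +oo)%E); last first.
    exists 1 => // x ex; have [->|[r xr]] := gtNy_cases (psiNy x); first exact: leey.
    by case: no; exists x; rewrite xr ltry.
  have [] := @argmin_exists h.
    split.
    - by move=> x; rewrite /h; case: ifP.
    - by exists x1; rewrite hE // lteBlDr // addye.
    - move=> x a; rewrite /h; case: ifPn => [xe _|xe ax].
        exists [set y | `|y - p| < e].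
          apply/(near_distP x); exists (e - `|x - p|); first by rewrite subr_gt0.
          by move=> y yx; have := ler_distD x y p; move: yx => /=; lra.
        by move=> y /= ->; rewrite ltry.
      have [V Vx Va] := tlsc x a ax; exists V => // y /Va.
      by case: ifP => // _ _; rewrite ltry.
    - move=> M; have [B BP] := tsup M; exists B => x; rewrite /h.
      by case: ifP => // _; exact: leey.
  move=> q; rewrite /h; case: ifPn => // qe; rewrite fin_numB => /andP[qfin _] qmin.
  have qp : fine (psi p) + dotv w (q - p) < fine (psi q).
    rewrite lt_neqAle (global_subgrad_fine pw qfin) andbT; apply/eqP => E.
    suff : q = p by move=> qp; move: qe; rewrite qp subrr normr0 e0.
    apply: uniq; split=> // x; rewrite -E -addrA -dotvDr [q - p + _]addrC addrA subrK.
    exact: pmin.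
  exists (fine (psi q) - (fine (psi p) + dotv w (q - p))); first by rewrite subr_gt0.
  move=> x ex; have := qmin x; rewrite -/(h x) hE // leeBrDr // => /(le_trans _); apply.
  by rewrite -[psi q in leRHS]fineK // -EFinB -EFinD lee_fin !dotvBr; lra.
(* Far away superlinearity gives slope 1/2; in between the gap suffices. *)
pose B := Num.max 1 (B0 + fine (psi p) - dotv w p).
have B_gt0 : 0 < B by rewrite lt_max ltr01.
have BB : B0 + fine (psi p) - dotv w p <= B by rewrite le_max lexx orbT.
pose c := Num.min 2^-1 (delta / (2 * B)).
have c0 : 0 < c by rewrite lt_min invr_gt0 ltr0n divr_gt0 // mulr_gt0.
exists c => // x ex; have xp0 := normr_ge0 (x - p).
have [far|close] := leP (2 * B) `|x - p|.
  have := B0P x; rewrite leeBrDr // => /(le_trans _); apply.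
  rewrite -EFinD lee_fin dotvBr.
  have : c * `|x - p| <= 2^-1 * `|x - p| by rewrite ler_wpM2r // ge_min lexx.
  lra.
apply: le_trans (gap x ex); rewrite lee_fin lerD2l.
apply: (@le_trans _ _ (delta / (2 * B) * (2 * B))); last first.
  by rewrite divfK // gt_eqF // mulr_gt0.
by rewrite ler_pM // ?ge_min ?lexx ?orbT // ltW.
Qed.

(** A perturbation of the tilt by less than the linear growth rate cannot move the
    minimizer out of the ball. *)
Lemma exposed_stable psi w p (e : R) : tiltable psi -> exposes psi w p -> 0 < e ->
  \forall w' \near w, forall q, global_subgrad psi q w' -> `|q - p| < e.
Proof.
move=> psiT pw e0; have [c c0 grow] := exposed_growth psiT pw e0.
apply/near_distP; exists (c / dimc m); first by rewrite divr_gt0 ?dimc_gt0.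
move=> w' ww' q [qfin qmin]; rewrite ltNge; apply/negP => eq.
have qp0 : 0 < `|q - p| by exact: lt_le_trans e0 eq.
have := grow q eq; rewrite -[psi q]fineK // lee_fin => H1.
have [[pfin pmin] _] := pw.
have := global_subgrad_fine (conj qfin qmin) pfin => H2.
have H3 : dotv (w' - w) (q - p) < c * `|q - p|.
  apply: (le_lt_trans (dotv_le _ _)); rewrite mulrA ltr_pM2r //.
  by rewrite mulrC -ltr_pdivlMr ?dimc_gt0.
by move: H2 H3; rewrite -(opprB q p) dotvNr dotvBl; lra.
Qed.

Lemma econjugateE psi p w : (forall x, -oo < psi x)%E -> global_subgrad psi p w ->
  econjugate psi w = (dotv w p - fine (psi p))%:E.
Proof.
move=> psiNy [pfin pmin]; apply/eqP; rewrite eq_le; apply/andP; split.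
  apply: ge_ereal_sup => _ [x _ <-].
  have [->|[r xr]] := gtNy_cases (psiNy x); first by rewrite addeNy leNye.
  have := pmin x; rewrite xr -EFinB !lee_fin dotvBr; lra.
by apply: ereal_sup_ubound; exists p => //; rewrite EFinB fineK.
Qed.

Lemma exposed_continuous psi w (P : 'rV[R]_m -> 'rV[R]_m) : tiltable psi ->
  (forall w', global_subgrad psi (P w') w') -> exposes psi w (P w) ->
  {for w, continuous P}.
Proof.
move=> psiT PP Pw; apply/continuous_distP => e e0.
by apply: filterS (exposed_stable psiT Pw e0) => w'; apply.
Qed.

(** Subgradients of [psi] at [P w] and [P w'] give
    [0 <= psi^* w' - psi^* w - <w' - w, P w> <= <w' - w, P w' - P w>],
    and the right-hand side is [o(w' - w)] by stability. *)
Lemma econjugate_frechet psi w (P : 'rV[R]_m -> 'rV[R]_m) : tiltable psi ->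
  (forall w', global_subgrad psi (P w') w') -> exposes psi w (P w) ->
  frechet (fine \o econjugate psi) w (P w).
Proof.
move=> psiT PP Pw e e0; have [psiNy _ _ _] := psiT.
have e'0 : 0 < e / dimc m by rewrite divr_gt0 ?dimc_gt0.
apply: filterS (exposed_stable psiT Pw e'0) => w' /(_ _ (PP w')) close.
rewrite /= (econjugateE psiNy (PP w')) (econjugateE psiNy (PP w)) /=.
have H1 := global_subgrad_fine (PP w) (PP w').1.
have H2 := global_subgrad_fine (PP w') (PP w).1.
set Pw' := P w' in H1 H2 close *; set p := P w in H1 H2 close *.
set a := fine (psi Pw') in H1 H2 *; set b := fine (psi p) in H1 H2 *.
have H3 : `|dotv (w' - w) (Pw' - p)| <= e * `|w' - w|.
  apply: (le_trans (dotv_bound _ _)); rewrite mulrCA mulrC ler_wpM2r //.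
  by rewrite mulrC -ler_pdivlMr ?dimc_gt0 // ltW.
apply: le_trans H3; rewrite ger0_norm.
  apply: le_trans (ler_norm _).
  move: H1; rewrite [dotv p _]dotvC !dotvBl !dotvBr; lra.
move: H2; rewrite [dotv p _]dotvC !dotvBl !dotvBr; lra.
Qed.

End TiltedMinimization.

(** * Legendre functions *)

Section LegendreFunctions.
Context {R : realType} {m : nat} (phi : 'rV[R]_m -> \bar R).
Hypotheses (phi_Gamma0 : Gamma0 phi) (phi_legendre : legendre phi).
Hypothesis (phi_coercive : super_coercive phi).
Implicit Types (p q u v w x y z : 'rV[R]_m).

Local Notation D := (edom phi)°.
Local Notation G := (egrad phi).
Local Notation rphi := (fine \o phi).

Lemma phi_gtNy x : (-oo < phi x)%E.
Proof. by have [[]] := phi_Gamma0. Qed.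

Lemma phi_edom_fin x : edom phi x -> phi x \is a fin_num.
Proof. by move=> xy; rewrite fin_real // phi_gtNy. Qed.

Lemma phi_int_edom x : D x -> edom phi x.
Proof. exact: interior_subset. Qed.

Lemma phi_int_fin x : D x -> phi x \is a fin_num.
Proof. by move/phi_int_edom; exact: phi_edom_fin. Qed.

Lemma phi_int_frechet x : D x -> frechet rphi x (G x).
Proof. by have [[_ dphi _] _] := phi_legendre; move=> /dphi[_ /diff_frechet]. Qed.

Lemma phi_convex_fine x y (t : R) : edom phi x -> edom phi y -> 0 < t < 1 ->
  edom phi (t *: x + (1 - t) *: y) /\
  rphi (t *: x + (1 - t) *: y) <= t * rphi x + (1 - t) * rphi y.
Proof.
move=> /phi_edom_fin xf /phi_edom_fin yf /andP[t0 t1].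
have [_ _ /(_ x y t t0 t1)] := phi_Gamma0.
rewrite -[in X in (_ <= X)%E](fineK xf) -[in X in (_ <= X)%E](fineK yf).
rewrite -!EFinM -EFinD => H.
have E : edom phi (t *: x + (1 - t) *: y) by exact: le_lt_trans H (ltry _).
by split=> //; rewrite -lee_fin /= fineK // phi_edom_fin.
Qed.

(** A ball around [z] inside the domain shrinks, by convexity, to a ball around the
    intermediate point. *)
Lemma int_edom_segment x z (t : R) : edom phi x -> D z -> 0 < t <= 1 ->
  D (x + t *: (z - x)).
Proof.
move=> xd Dz /andP[t0]; rewrite le_eqVlt => /orP[/eqP ->|t1].
  by rewrite scale1r [x + _]addrC subrK.
have [d d0 dP] := (near_distP _ _).1 Dz.
apply/(near_distP (x + t *: (z - x))); exists (t * d); first by rewrite mulr_gt0.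
move=> y; set c := x + _ => yc.
pose z' := z + t^-1 *: (y - c).
have z'd : edom phi z'.
  apply: dP; rewrite /z' addrDBl normrZ gtr0_norm ?invr_gt0 //.
  by rewrite ltr_pdivrMl.
have -> : y = t *: z' + (1 - t) *: x.
  rewrite /z' scalerDr scalerA divff ?gt_eqF // scale1r /c.
  by apply/rowP => i; rewrite !mxE; ring.
by apply: (phi_convex_fine z'd xd _).1; rewrite t0.
Qed.

Lemma int_edom_segment_int x z (t : R) : D x -> D z -> 0 <= t <= 1 ->
  D (x + t *: (z - x)).
Proof.
move=> Dx Dz /andP[]; rewrite le_eqVlt => /orP[/eqP <- _|t0 t1].
  by rewrite scale0r addr0.
by apply: int_edom_segment => //; [exact: phi_int_edom|rewrite t0].
Qed.

Lemma gradient_inequality y : D y -> global_subgrad phi y (G y).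
Proof.
move=> Dy; split=> [|x]; first exact: phi_int_fin.
have [->|[r xr]] := gtNy_cases (phi_gtNy x); first exact: leey.
have xd : edom phi x by rewrite /edom /= xr ltry.
rewrite xr lee_fin -lerBrDl; apply/ler_addgt0Pr => e e0.
have [xy|xy] := eqVneq x y.
  by rewrite xy subrr dotv0r -xy xr /= subrr add0r ltW.
have n0 : 0 < `|x - y| by rewrite normr_gt0 subr_eq0.
have [d d0 dP] := (near_distP _ _).1 (phi_int_frechet Dy (divr_gt0 e0 n0)).
pose t := Num.min (d / `|x - y|) 1 / 2.
have m0 : 0 < Num.min (d / `|x - y|) 1 by rewrite lt_min ltr01 divr_gt0.
have t0 : 0 < t by rewrite divr_gt0.
have tm : t < Num.min (d / `|x - y|) 1 by rewrite /t; lra.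
have /andP[td t1] : (t < d / `|x - y|) && (t < 1) by rewrite -lt_min.
have [|_] := @phi_convex_fine x y t xd (phi_int_edom Dy); first by rewrite t0.
have -> : t *: x + (1 - t) *: y = y + t *: (x - y).
  by apply/rowP => i; rewrite !mxE; ring.
have := dP (y + t *: (x - y)); rewrite addrDBl normrZ gtr0_norm //.
rewrite -ltr_pdivlMr // => /(_ td); rewrite dotvZr ler_norml => /andP[H _].
move: H; rewrite mulrCA divfK ?gt_eqF // => H1 H2.
have xr' : rphi x = r by rewrite /= xr.
rewrite xr' in H2; rewrite -(ler_pM2l t0).
by move: H1 H2 => /=; lra.
Qed.

Lemma dotvv_eq0 v : dotv v v <= 0 -> v = 0.
Proof.
move=> v0; apply/eqP; rewrite -normr_eq0 eq_le normr_ge0 andbT.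
by apply: (le_trans (norm_le_enorm v)); rewrite /enorm ler0_sqrtr.
Qed.

Lemma global_subgrad_grad x w : D x -> global_subgrad phi x w -> w = G x.
Proof.
move=> Dx xw; apply/eqP; rewrite -subr_eq0; apply/eqP.
set v := w - G x; apply: dotvv_eq0; apply/ler_addgt0Pr => e e0.
have [->|vn0] := eqVneq v 0; first by rewrite dotv0r add0r ltW.
have n0 : 0 < `|v| by rewrite normr_gt0.
have [d1 d10 dP1] := (near_distP _ _).1 (phi_int_frechet Dx (divr_gt0 e0 n0)).
have [d2 d20 dP2] := (near_distP _ _).1 Dx.
pose t := Num.min d1 d2 / (2 * `|v|).
have m0 : 0 < Num.min d1 d2 by rewrite lt_min d10.
have t0 : 0 < t by rewrite divr_gt0 // mulr_gt0.
have tm : t * `|v| < Num.min d1 d2.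
  by rewrite /t invfM mulrA divfK ?gt_eqF //; lra.
have /andP[td1 td2] : (t * `|v| < d1) && (t * `|v| < d2) by rewrite -lt_min.
have := dP1 (x + t *: v); have := dP2 (x + t *: v).
rewrite addrDBl normrZ gtr0_norm // => /(_ td2) xvd /(_ td1).
have := global_subgrad_fine xw (phi_edom_fin xvd).
rewrite addrDBl !dotvZr mulrCA divfK ?gt_eqF // ler_norml => H1 /andP[_ H2].
rewrite -(ler_pM2l t0) add0r {1}/v dotvBl; move: H1 H2 => /=; lra.
Qed.

(** Super-coercivity controls [phi] outside a ball and the affine minorant given by a
    gradient controls it inside. *)
Lemma phi_tiltable : tiltable phi.
Proof.
have [[_ phiy] lsc _] := phi_Gamma0.
split=> //; first exact: phi_gtNy.
move=> M; have [[[z Dz] _ _] _] := phi_legendre.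
pose M' := Num.max M 0; have M'0 : 0 <= M' by rewrite le_max lexx orbT.
have MM' : M <= M' by rewrite le_max lexx.
have [K KP] := phi_coercive M'; pose K' := Num.max K 0.
have K'0 : 0 <= K' by rewrite le_max lexx orbT.
pose B := M' * K' + dimc m * `|G z| * (K' + `|z|) + `|fine (phi z)|.
have c0 : 0 <= dimc m * `|G z| :> R by rewrite mulr_ge0 // ltW // dimc_gt0.
have B0 : 0 <= B by rewrite /B !addr_ge0 // mulr_ge0 // addr_ge0.
exists B => x.
have Mx : M * `|x| <= M' * `|x| by rewrite ler_wpM2r.
have [xK|Kx] := leP (enorm x) K'.
  have xK' : `|x| <= K' by exact: le_trans (norm_le_enorm x) xK.
  apply: le_trans ((gradient_inequality Dz).2 x); rewrite lee_fin.
  have H1 : M' * `|x| <= M' * K' by rewrite ler_wpM2l.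
  have H2 : - (dimc m * `|G z| * (K' + `|z|)) <= dotv (G z) (x - z).
    rewrite lerNl; apply: (le_trans (ler_norm _)); rewrite normrN.
    apply: (le_trans (dotv_bound _ _)); rewrite mulrA ler_wpM2l //.
    by apply: (le_trans (ler_normB _ _)); rewrite lerD2r.
  have := ler_norm (- fine (phi z)); rewrite normrN /B; lra.
have Kx' : K < enorm x by apply: le_lt_trans Kx; rewrite le_max lexx.
have x0 : 0 < enorm x by exact: le_lt_trans Kx.
have := KP x Kx'; have [->|[r ->]] := gtNy_cases (phi_gtNy x); first by rewrite leey.
rewrite -EFinM lte_fin lee_fin ltr_pdivlMr // => H.
have : M' * `|x| <= M' * enorm x by rewrite ler_wpM2l // norm_le_enorm.
lra.
Qed.

(** Suppose that [x] is a boundary point carrying a subgradient [w]. Along the segment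
    from [x] to an interior point [z] convexity makes [G - w] point towards [z], so an
    upper bound of [phi] near [z] bounds [G] along the whole segment, against essential
    smoothness. *)
Lemma global_subgrad_int x w : global_subgrad phi x w -> D x.
Proof.
move=> xw; apply: contrapT => nDx.
have [[[z Dz] dphi blow] _] := phi_legendre.
have [xfin _] := xw.
have xd : edom phi x by move: xfin; rewrite fin_numElt => /andP[].
pose u (n : nat) := x + harmonic n *: (z - x) : 'rV[R]_m.
have h01 n : 0 < (harmonic n : R) <= 1.
  by rewrite /= invr_gt0 ltr0Sn invf_le1 ?ltr0Sn // ler1n.
have Du n : D (u n) by exact: int_edom_segment.
have ux : u @ \oo --> x.
  rewrite -[X in _ --> X]addr0 -[X in _ + X](scale0r (z - x)).
  apply: cvgD; first exact: cvg_cst.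
  by apply: cvgZr_tmp; exact: cvg_harmonic.
have bx : bdry (edom phi) x by split=> //; exact: subset_closure.
have := blow u x Du bx ux.
(* phi is bounded above near z, which bounds the gradients along the segment. *)
have [d1 d10 dP1] := (near_distP _ _).1 (phi_int_frechet Dz ltr01).
have [d2 d20 dP2] := (near_distP _ _).1 Dz.
pose e := Num.min d1 d2 / 2.
have m0 : 0 < Num.min d1 d2 by rewrite lt_min d10.
have e0 : 0 < e by rewrite divr_gt0.
have em : e < Num.min d1 d2 by rewrite /e; lra.
have /andP[ed1 ed2] : (e < d1) && (e < d2) by rewrite -lt_min.
pose C := rphi z + dimc m * (`|G z| * e) + e - rphi x
  + dimc m * (`|w| * (e + `|z - x|)).
have gbound n : e * `|G (u n) - w| <= C.
  set g := G (u n) - w; pose t : R := harmonic n.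
  have /andP[t0 t1] := h01 n; rewrite -/t in t0 t1.
  pose s := `|g|^-1 *: g.
  have s1 : `|s| <= 1.
    rewrite /s normrZ normfV normr_id.
    have [->|gn0] := eqVneq g 0; first by rewrite normr0 mulr0.
    by rewrite mulVf // normr_eq0.
  have gs : `|g| <= dotv g s.
    rewrite /s dotvZr; have [->|gn0] := eqVneq g 0; first by rewrite normr0 dotv0r mulr0.
    rewrite ler_pdivlMl ?normr_gt0 // -expr2.
    have := norm_le_enorm g; rewrite -(ler_pXn2r (ltn0Sn 1)) ?nnegrE ?sqrtr_ge0 //.
    by rewrite sqr_sqrtr ?dotvv_ge0.
  have es : `|e *: s| <= e by rewrite normrZ gtr0_norm // ler_piMr // ltW.
  have zsd : edom phi (z + e *: s).
    by apply: dP2; rewrite addrDBl; exact: le_lt_trans ed2.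
  have := dP1 (z + e *: s); rewrite addrDBl => /(_ (le_lt_trans es ed1)).
  rewrite ler_norml mul1r => /andP[_ Hz].
  have Hz2 := dotv_le (G z) (e *: s).
  have Hz3 : dimc m * (`|G z| * `|e *: s|) <= dimc m * (`|G z| * e).
    by rewrite ler_pM2l ?dimc_gt0 // ler_wpM2l.
  have H1 := global_subgrad_fine (gradient_inequality (Du n)) (phi_edom_fin zsd).
  have H2 := global_subgrad_fine (gradient_inequality (Du n)) xfin.
  have H3 := global_subgrad_fine xw (phi_int_fin (Du n)).
  have ud : u n - x = t *: (z - x) by rewrite /u addrDBl.
  have xu : x - u n = - (t *: (z - x)) by rewrite -ud opprB.
  have zu : z + e *: s - u n = e *: s + (1 - t) *: (z - x).
    by rewrite /u -/t; apply/rowP => i; rewrite !mxE; ring.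
  have gpos : 0 <= dotv g (z - x).
    rewrite -(pmulr_rge0 _ t0) /g dotvBl.
    move: H2 H3; rewrite xu ud dotvNr !dotvZr; lra.
  have gpos' : 0 <= (1 - t) * dotv g (z - x) by rewrite mulr_ge0 // subr_ge0.
  have Hw : - dotv w (e *: s + (z - x)) <= dimc m * (`|w| * (e + `|z - x|)).
    apply: (le_trans (ler_norm _)); rewrite normrN.
    apply: (le_trans (dotv_bound _ _)); rewrite ler_pM2l ?dimc_gt0 // ler_wpM2l //.
    by apply: (le_trans (ler_normD _ _)); rewrite lerD2r.
  have gs' : e * `|g| <= e * dotv g s by rewrite ler_pM2l.
  have GE : G (u n) = g + w by rewrite /g subrK.
  move: H1 H3 Hw Hz Hz2 Hz3 gs' gpos' gs; rewrite zu ud GE /C.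
  move: (z - x) => d.
  rewrite !dotvDl !dotvDr !dotvZr /=; lra.
move=> /cvgryPgt /(_ (dimc m * (C / e + `|w|))) [N _ /(_ N (leqnn N))] /=.
apply/negP; rewrite -leNgt; apply: (le_trans (enorm_le_norm _)).
rewrite ler_pM2l ?dimc_gt0 // -[X in `|X|](subrK w).
apply: (le_trans (ler_normD _ _)); rewrite lerD2r ler_pdivlMr // mulrC.
exact: gbound.
Qed.

Lemma int_edom_convex : convex_set (D : set (convex_lmodType 'rV[R]_m)).
Proof.
apply/convex_setW => x y /set_mem Dx /set_mem Dy k k0 k1; apply/mem_set.
have -> : conv k x y = y + k%:num *: (x - y) :> 'rV[R]_m.
  rewrite /conv /=; apply/rowP => i; rewrite !mxE /unstable.onem; ring.
by apply: int_edom_segment_int => //; rewrite !ltW.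
Qed.

Lemma regular_limiting f x v : regular_subdiff f x v -> limiting_subdiff f x v.
Proof.
move=> xv; split; first by case: xv.
exists (fun=> x), (fun=> v).
by split=> //; exact: cvg_cst.
Qed.

Lemma phi_int_dom_subdiff : D `<=` dom_subdiff phi.
Proof.
move=> x Dx; exists (G x); apply: regular_limiting; split; first exact: phi_int_fin.
move=> e e0; apply/(near_distP x); exists 1 => // y _; have [xf /(_ y)] := gradient_inequality Dx.
apply: le_trans; rewrite -[phi x in leLHS]fineK // -EFinD lee_fin lerD2l.
by rewrite gerBl /enorm mulr_ge0 ?sqrtr_ge0 // ltW.
Qed.

(** Two points with the same subgradient are both interior, and [phi] is affine on the
    segment between them, against strict convexity. *)
Lemma phi_subgrad_inj p q w :
  global_subgrad phi p w -> global_subgrad phi q w -> p = q.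
Proof.
move=> pw qw; apply/eqP; apply: contrapT => /negP pq.
have Dp := global_subgrad_int pw; have Dq := global_subgrad_int qw.
have [_ strict] := phi_legendre.
have h0 : 0 < 2^-1 :> R by rewrite invr_gt0.
have h1 : 2^-1 < 1 :> R by lra.
have := strict D int_edom_convex phi_int_dom_subdiff p q 2^-1 Dp Dq pq h0 h1.
set z := _ + _.
have Dz : D z.
  rewrite (_ : z = q + 2^-1 *: (p - q)); last first.
    by apply/rowP => i; rewrite !mxE; ring.
  by apply: int_edom_segment_int => //; rewrite !ltW.
have pf := phi_int_fin Dp; have qf := phi_int_fin Dq; have zf := phi_int_fin Dz.
rewrite -(fineK pf) -(fineK qf) -(fineK zf) -!EFinM -EFinD lte_fin.
have := global_subgrad_fine pw zf; have := global_subgrad_fine qw zf.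
have -> : z - p = 2^-1 *: (q - p) by apply/rowP => i; rewrite !mxE; field.
have -> : z - q = 2^-1 *: (p - q) by apply/rowP => i; rewrite !mxE; field.
rewrite !dotvZr !dotvBr; lra.
Qed.

Lemma grad_exposes y : D y -> exposes phi (G y) y.
Proof.
by move=> Dy; split=> [|q qy]; [exact: gradient_inequality|
  exact/phi_subgrad_inj/gradient_inequality].
Qed.

(** [phi] has exactly one tilted minimizer for every tilt, and it is an interior point. *)
Lemma grad_conjugate w : exists p,
  [/\ D p, G p = w, egrad (econjugate phi) w = p &
      frechet (fine \o econjugate phi) w p].
Proof.
have [P PP] := choice (fun w => global_subgrad_exists w phi_tiltable).
have Dp := global_subgrad_int (PP w).
have Pw : exposes phi w (P w).
  by split=> // q qw; exact: phi_subgrad_inj qw (PP w).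
have fr := econjugate_frechet phi_tiltable PP Pw.
exists (P w); split=> //; first by rewrite -(global_subgrad_grad Dp (PP w)).
by have [] := frechet_diff fr.
Qed.

Lemma conjugate_frechet_grad y : D y ->
  frechet (fine \o econjugate phi) (G y) y.
Proof.
move=> Dy; have [p [Dp Gp _]] := grad_conjugate (G y).
suff -> : p = y by [].
apply: (@phi_subgrad_inj _ _ (G y)); last exact: gradient_inequality.
by rewrite -Gp; exact: gradient_inequality.
Qed.

End LegendreFunctions.

(** * The left Bregman-Moreau envelope under relative prox-regularity *)

Section BregmanEnvelope.
Context {R : realType} {m : nat} (phi f : 'rV[R]_m -> \bar R).
Hypotheses (phi_Gamma0 : Gamma0 phi) (phi_legendre : legendre phi).
Hypothesis (phi_coercive : super_coercive phi).
Hypotheses (f_proper : eproper f) (f_lsc : lower_semicontinuous f).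
Implicit Types (p q u v w x y z : 'rV[R]_m) (lam : R).

Local Notation D := (edom phi)°.
Local Notation G := (egrad phi).
Local Notation rphi := (fine \o phi).
Local Notation rf := (fine \o f).

Definition breg x y : R := rphi x - rphi y - dotv (G y) (x - y).

Definition penalized lam x : \bar R := (lam%:E * f x + phi x)%E.

Lemma f_gtNy x : (-oo < f x)%E.
Proof. by have [] := f_proper. Qed.

(** Linear growth away from the minimizer of [phi] tilted by [G y], which is [y] alone. *)
Lemma breg_gt0 x y : D y -> phi x \is a fin_num -> x != y -> 0 < breg x y.
Proof.
move=> Dy xfin xy; have n0 : 0 < `|x - y| by rewrite normr_gt0 subr_eq0.
have [c c0 /(_ x (lexx _))] := exposed_growth (phi_tiltable phi_Gamma0
  phi_legendre phi_coercive) (grad_exposes phi_Gamma0 phi_legendre Dy) n0.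
have : 0 < c * `|x - y| by rewrite mulr_gt0.
by rewrite -{1}(fineK xfin) lee_fin /breg /=; lra.
Qed.

Lemma bregmanE x y : D y -> phi x \is a fin_num ->
  bregman phi x y = (breg x y)%:E.
Proof.
move=> Dy xfin; rewrite /bregman asboolT //.
by rewrite -(fineK xfin) -(fineK (phi_int_fin phi_Gamma0 Dy)).
Qed.

Lemma bregman_infinite x y : D y -> phi x = +oo%E -> bregman phi x y = +oo%E.
Proof.
move=> Dy px; rewrite /bregman asboolT //= px.
by rewrite -(fineK (phi_int_fin phi_Gamma0 Dy)) addye // addye.
Qed.

(** The convention that a sum is infinite as soon as a term is, since neither [f] nor
    [phi] takes the value minus infinity. *)
Variant penalized_spec lam x : \bar R -> Prop :=
| PenalizedInfinite of f x = +oo%E \/ phi x = +oo%E : penalized_spec lam x +oo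
| PenalizedFinite of f x \is a fin_num & phi x \is a fin_num :
    penalized_spec lam x (lam * rf x + rphi x)%:E.

Lemma penalizedP lam x : 0 < lam -> penalized_spec lam x (penalized lam x).
Proof.
move=> lam0; rewrite /penalized.
have [fx|[a fx]] := gtNy_cases (f_gtNy x).
  rewrite fx gt0_muley ?lte_fin // addye; last by rewrite gt_eqF ?phi_gtNy.
  by constructor; left.
have [px|[b px]] := gtNy_cases (phi_gtNy phi_Gamma0 x).
  by rewrite px fx -EFinM addey //; constructor; right.
rewrite px fx -EFinM -EFinD.
have -> : a = rf x by rewrite /= fx.
have -> : b = rphi x by rewrite /= px.
by constructor; rewrite ?fx ?px.
Qed.

Lemma penalized_fine lam x : f x \is a fin_num -> phi x \is a fin_num ->
  penalized lam x = (lam * rf x + rphi x)%:E.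
Proof. by move=> ff pf; rewrite /penalized -{1}(fineK ff) -{1}(fineK pf). Qed.

Lemma penalized_fin lam x : 0 < lam -> penalized lam x \is a fin_num ->
  [/\ f x \is a fin_num, phi x \is a fin_num &
      fine (penalized lam x) = lam * rf x + rphi x].
Proof. by move=> lam0; case: penalizedP. Qed.

(** Expanding the Bregman distance: the objective is an affine image of [lam f + phi]
    tilted by [G y]. *)
Lemma left_objE lam x y : 0 < lam -> D y ->
  left_obj phi lam f y x =
  (lam^-1%:E * (penalized lam x - (rphi y + dotv (G y) (x - y))%:E))%E.
Proof.
move=> lam0 Dy; have l0 : 0 < lam^-1 by rewrite invr_gt0.
have yfin := phi_int_fin phi_Gamma0 Dy.
rewrite /left_obj; case: (penalizedP x lam0) => [[fx|px]|ff pf].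
- have bN : (lam^-1%:E * bregman phi x y)%E != -oo%E.
    have [px|[b px]] := gtNy_cases (phi_gtNy phi_Gamma0 x); last first.
      by rewrite bregmanE ?px // -EFinM.
    by rewrite bregman_infinite // gt0_muley ?lte_fin.
  by rewrite fx !addye // gt0_muley ?lte_fin.
- by rewrite bregman_infinite // addye // !gt0_muley ?lte_fin // addey // gt_eqF // f_gtNy.
rewrite bregmanE // -{1}(fineK ff) -EFinM -EFinB -EFinM -EFinD /breg.
by congr (_%:E); rewrite /=; field; rewrite gt_eqF.
Qed.

(** A real number below a sum splits into a real number below each term. *)
Lemma penalized_lsc lam : 0 < lam -> lower_semicontinuous (penalized lam).
Proof.
move=> lam0 x a ax; have [_ phi_lsc _] := phi_Gamma0.
have lamn0 : lam != 0 by rewrite gt_eqF.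
have [b [c [bx cx E]]] : exists b c : R,
    [/\ (b%:E < f x)%E, (c%:E < phi x)%E & lam * b + c = a].
  have [px|[s px]] := gtNy_cases (phi_gtNy phi_Gamma0 x).
    have [b bx] : exists b : R, (b%:E < f x)%E.
      have [fx|[r fx]] := gtNy_cases (f_gtNy x); first by exists 0; rewrite fx ltry.
      by exists (r - 1); rewrite fx lte_fin gtrBl.
    exists b, (a - lam * b); rewrite px ltry bx; split=> //; ring.
  have [fx|[r fx]] := gtNy_cases (f_gtNy x).
    exists ((a - (s - 1)) / lam), (s - 1); rewrite fx px ltry lte_fin gtrBl.
    by split=> //; field.
  have : a < lam * r + s by move: ax; rewrite /penalized fx px -EFinM -EFinD lte_fin.
  move=> ars; exists (r - (lam * r + s - a) / (2 * lam)), (s - (lam * r + s - a) / 2).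
  rewrite fx px !lte_fin; split; last by field.
    by rewrite gtrBl divr_gt0 ?mulr_gt0 // subr_gt0.
  by rewrite gtrBl divr_gt0 // subr_gt0.
have [V1 V1x V1b] := f_lsc bx; have [V2 V2x V2c] := phi_lsc _ _ cx.
exists (V1 `&` V2); first exact: filterI.
move=> z [/V1b bz /V2c cz]; case: (penalizedP z lam0) => [_|ff pf]; first exact: ltry.
move: bz cz; rewrite -(fineK ff) -(fineK pf) !lte_fin -E => bz cz.
have : lam * b < lam * fine (f z) by rewrite ltr_pM2l.
by rewrite /=; lra.
Qed.

(** What prox-boundedness with parameter [lam1] provides in terms of real numbers. *)
Definition minorized lam1 y1 (b : R) : Prop :=
  forall x, f x \is a fin_num -> phi x \is a fin_num ->
    b - lam1^-1 * breg x y1 <= rf x.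

Lemma prox_bounded_minorized : prox_bounded phi f ->
  (exists x, f x \is a fin_num /\ phi x \is a fin_num) ->
  exists lam1 y1 b, [/\ 0 < lam1, D y1 & minorized lam1 y1 b].
Proof.
move=> [lam1 [lam10 [y1 Dy1 env1]]] [x0 [f0 p0]].
have le x : f x \is a fin_num -> phi x \is a fin_num ->
    (left_env phi lam1 f y1 <= (rf x + lam1^-1 * breg x y1)%:E)%E.
  move=> ff pf; apply: ereal_inf_lbound; exists x => //.
  by rewrite /left_obj bregmanE // -{1}(fineK ff) -EFinM -EFinD.
exists lam1, y1, (fine (left_env phi lam1 f y1)); split=> // x ff pf.
have env_fin : left_env phi lam1 f y1 \is a fin_num.
  by rewrite fin_real // env1 (le_lt_trans (le x0 f0 p0)) ?ltry.
by rewrite lerBlDr -lee_fin fineK //; exact: le.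
Qed.

(** The minorant of [f] costs only the fraction [lam / lam1 < 1] of [phi], and what
    remains of [phi] is still superlinear. *)
Lemma penalized_tiltable lam lam1 y1 b : 0 < lam < lam1 -> D y1 ->
  minorized lam1 y1 b ->
  (exists x, f x \is a fin_num /\ phi x \is a fin_num) ->
  tiltable (penalized lam).
Proof.
move=> /andP[lam0 lam_lt] Dy1 minor [x0 [f0 p0]].
have lam10 : 0 < lam1 by exact: lt_trans lam_lt.
split.
- by move=> x; case: penalizedP => // *; rewrite ?ltNyr.
- by exists x0; rewrite penalized_fine ?ltry.
- exact: penalized_lsc.
move=> M; pose t := lam / lam1.
have t0 : 0 < t by rewrite divr_gt0.
have t1 : t < 1 by rewrite ltr_pdivrMr // mul1r.
have t1' : 0 < 1 - t by rewrite subr_gt0.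
have [_ _ _ sup] := phi_tiltable phi_Gamma0 phi_legendre phi_coercive.
pose N := dimc m * `|G y1|.
have N0 : 0 <= N by rewrite mulr_ge0 // ltW // dimc_gt0.
have [B BP] := sup ((M + t * N) / (1 - t)).
exists ((1 - t) * B - lam * b - t * rphi y1 + t * (N * `|y1|)) => x.
case: penalizedP => // [_|ff pf]; first exact: leey.
have := BP x; rewrite -{1}(fineK pf) !lee_fin -(ler_pM2l t1').
have -> : (1 - t) * ((M + t * N) / (1 - t) * `|x| - B) =
  (M + t * N) * `|x| - (1 - t) * B by field; rewrite gt_eqF.
move=> H1.
have H2 : lam * (b - lam1^-1 * breg x y1) <= lam * rf x by rewrite ler_pM2l // minor.
rewrite mulrBr mulrA -/t /breg in H2.
have H3 : - dotv (G y1) (x - y1) <= N * (`|x| + `|y1|).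
  apply: (le_trans (ler_norm _)); rewrite normrN; apply: (le_trans (dotv_bound _ _)).
  by rewrite mulrA ler_wpM2l // ler_normB.
have H4 : t * - dotv (G y1) (x - y1) <= t * (N * (`|x| + `|y1|)) by rewrite ler_pM2l.
by move: H1 H2 H4 => /=; lra.
Qed.

Section LocalAnalysis.
Variables (xbar vbar : 'rV[R]_m).
Hypothesis phi_C2 : C2_on phi D.
Hypotheses (xbar_int : D xbar) (xbar_fin : f xbar \is a fin_num).

Lemma grad_continuous y : D y -> {for y, continuous G}.
Proof. by move=> /phi_C2[_ dG _]; exact: differentiable_continuous. Qed.

(** Relative prox-regularity between points where [f] is finite, with radii in the
    max norm. *)
Definition prox_regular_ineq (e r : R) : Prop :=
  forall x' x v, `|x' - xbar| < e -> `|x - xbar| < e -> f x' \is a fin_num ->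
    f x \is a fin_num -> rf x < rf xbar + e -> limiting_subdiff f x v ->
    `|v - vbar| < e -> rf x + dotv v (x' - x) - r * breg x' x <= rf x'.

Lemma relatively_prox_regular_ineq : relatively_prox_regular phi f xbar vbar ->
  exists e r : R, [/\ 0 < e, 0 <= r,
    forall x, `|x - xbar| < e -> D x & prox_regular_ineq e r].
Proof.
move=> [_ _ _ [e [r [e0 r0 eD ineq]]]].
have c0 : 0 < dimc m :> R by exact: dimc_gt0.
have e'0 : 0 < e / dimc m by rewrite divr_gt0.
have e'e : e / dimc m <= e by rewrite ler_pdivrMr // ler_peMr ?dimc_ge1 // ltW.
have small x y : `|x - y| < e / dimc m -> enorm (x - y) < e.
  move=> xy; apply: (le_lt_trans (enorm_le_norm _)).
  by rewrite mulrC -ltr_pdivlMr.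
have eD' x : `|x - xbar| < e / dimc m -> D x by move=> /small/eD.
exists (e / dimc m), r; split=> // x' x v x'e xe f' ff close lim vv.
have p' := phi_int_fin phi_Gamma0 (eD' _ x'e).
have close' : (f x - f xbar < e%:E)%E.
  rewrite -(fineK ff) -(fineK xbar_fin) -EFinB lte_fin ltrBlDl.
  by apply: lt_le_trans close _; rewrite lerD2l.
have := ineq x' x v (small _ _ x'e) (small _ _ xe) close' lim (small _ _ vv).
rewrite bregmanE //; last exact: eD'.
by rewrite -(fineK ff) -(fineK f') -EFinM -!EFinD lee_fin.
Qed.

(** With [d = |x - xbar|], the excess of the tilted function at [x] over its value at
    [xbar] is at least [(1 - lam r) D] for [d < e], and at least
    [(1 - lam / lam1) D - lam K d] for [d >= e], where [D >= c d]. *)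
Lemma penalized_exposes (e r : R) :
  limiting_subdiff f xbar vbar -> prox_bounded phi f ->
  0 < e -> 0 <= r -> (forall x, `|x - xbar| < e -> D x) -> prox_regular_ineq e r ->
  exists2 lam0, 0 < lam0 & forall lam, 0 < lam -> lam < lam0 ->
    [/\ tiltable (penalized lam), lam * r < 1 &
        exposes (penalized lam) (G xbar + lam *: vbar) xbar].
Proof.
move=> vsub pb e0 r0 eD ineq.
have xp := phi_int_fin phi_Gamma0 xbar_int.
have dom : exists x, f x \is a fin_num /\ phi x \is a fin_num by exists xbar.
have [lam1 [y1 [b [lam10 Dy1 minor]]]] := prox_bounded_minorized pb dom.
have [c c0 grow] := exposed_growth (phi_tiltable phi_Gamma0
  phi_legendre phi_coercive) (grad_exposes phi_Gamma0 phi_legendre xbar_int) e0.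
pose A := lam1^-1 * `|breg xbar y1| + `|rf xbar - b|.
pose B := dimc m * (lam1^-1 * `|G xbar - G y1| + `|vbar|).
have A0 : 0 <= A by rewrite addr_ge0 // mulr_ge0 // invr_ge0 ltW.
have B0 : 0 <= B.
  apply: mulr_ge0; first by rewrite ltW // dimc_gt0.
  by rewrite addr_ge0 // mulr_ge0 // invr_ge0 ltW.
pose K := A / e + B.
have K0 : 0 <= K by rewrite addr_ge0 // divr_ge0 // ltW.
have K10 : 0 < 2 * (K + 1) by rewrite mulr_gt0 // ltr_wpDl.
have r10 : 0 < r + 1 by rewrite ltr_wpDl.
(* The three bounds give lam / lam1 <= 1 / 2, lam K < c / 2 and lam r < 1. *)
exists (Num.min (lam1 / 2) (Num.min (c / (2 * (K + 1))) (r + 1)^-1)).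
  by rewrite !lt_min invr_gt0 r10 !divr_gt0.
move=> lam lam0; rewrite !lt_min => /and3P[lamlam1 lamc lamr].
have lam_lt : lam < lam1 by lra.
have lr1 : lam * r < 1.
  have : lam * (r + 1) < 1 by rewrite -ltr_pdivlMr // mul1r.
  by lra.
have strict x : f x \is a fin_num -> phi x \is a fin_num -> x != xbar ->
    lam * rf xbar + rphi xbar + dotv (G xbar + lam *: vbar) (x - xbar) <
    lam * rf x + rphi x.
  move=> ff pf xx; have bx := breg_gt0 xbar_int pf xx.
  have [near|far] := ltP `|x - xbar| e.
    have := @ineq x xbar vbar near; rewrite !subrr normr0 e0.
    move=> /(_ isT ff xbar_fin); rewrite ltrDl e0 => /(_ isT vsub isT) H.
    have H1 : lam * (rf xbar + dotv vbar (x - xbar) - r * breg x xbar) <= lam * rf x.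
      by rewrite ler_pM2l.
    have H2 : 0 < (1 - lam * r) * breg x xbar by rewrite mulr_gt0 // subr_gt0.
    by move: H1 H2; rewrite dotvDl dotvZl /breg; lra.
  have := grow x far; rewrite -{1}(fineK pf) lee_fin => H1.
  have {}H1 : c * `|x - xbar| <= breg x xbar by rewrite /breg /=; lra.
  have H2 := minor x ff pf.
  have bE : breg x y1 = breg x xbar + breg xbar y1 + dotv (G xbar - G y1) (x - xbar).
    by rewrite /breg dotvBl !dotvBr; ring.
  pose d := `|x - xbar|.
  have dn0 : 0 < d by exact: lt_le_trans e0 far.
  have H3 : lam1^-1 * (breg xbar y1 + dotv (G xbar - G y1) (x - xbar)) + (rf xbar - b)
      + dotv vbar (x - xbar) <= K * d.
    have h1 : lam1^-1 * breg xbar y1 <= lam1^-1 * `|breg xbar y1|.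
      by rewrite ler_pM2l ?invr_gt0 // ler_norm.
    have h2 : lam1^-1 * dotv (G xbar - G y1) (x - xbar) <=
        lam1^-1 * (dimc m * (`|G xbar - G y1| * d)).
      by rewrite ler_pM2l ?invr_gt0 // dotv_le.
    have h3 := ler_norm (rf xbar - b).
    have h4 := dotv_le vbar (x - xbar).
    have h5 : A <= A / e * d by rewrite mulrAC ler_pdivlMr // ler_wpM2l.
    by move: h1 h2 h3 h4 h5; rewrite /K /B /A -/d; lra.
  have H4 : lam * (b - lam1^-1 * breg x y1) <= lam * rf x by rewrite ler_pM2l.
  have H5 : lam * (lam1^-1 * (breg xbar y1 + dotv (G xbar - G y1) (x - xbar)) +
      (rf xbar - b) + dotv vbar (x - xbar)) <= lam * (K * d) by rewrite ler_pM2l.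
  have t2 : lam * lam1^-1 <= 2^-1 by rewrite ler_pdivrMr //; lra.
  have H6 : lam * lam1^-1 * breg x xbar <= 2^-1 * breg x xbar.
    by rewrite ler_wpM2r // ltW.
  have H7 : lam * (K * d) < c * d / 2.
    have : lam * (2 * (K + 1)) * d < c * d by rewrite ltr_pM2r // -ltr_pdivlMr.
    have : 0 < lam * d by rewrite mulr_gt0.
    by lra.
  move: H1 H4 H5 H6 H7; rewrite bE -/d [dotv (_ + lam *: _) _]dotvDl dotvZl /breg; lra.
split=> //.
  by apply: penalized_tiltable minor dom => //; rewrite lam0.
have xE := penalized_fine lam xbar_fin xp.
have xsub : global_subgrad (penalized lam) xbar (G xbar + lam *: vbar).
  split=> [|x]; first by rewrite xE.
  rewrite xE /=; case: penalizedP => // [_|ff pf]; first exact: leey.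
  have [->|xx] := eqVneq x xbar; first by rewrite subrr dotv0r addr0.
  by rewrite lee_fin ltW //; exact: strict.
split=> // q qsub; apply: contrapT => /eqP qx.
have [ff pf qE] := penalized_fin lam0 qsub.1.
have := global_subgrad_fine qsub xsub.1.
rewrite qE xE /= => H; have := strict q ff pf qx.
move: H; rewrite -(opprB q xbar) dotvNr /=; lra.
Qed.

(** Fermat's rule: [psi] has subgradient [w] at [q] and [phi] is differentiable there. *)
Lemma penalized_regular_subdiff lam w q : 0 < lam -> D q ->
  global_subgrad (penalized lam) q w ->
  regular_subdiff f q (lam^-1 *: (w - G q)).
Proof.
move=> lam0 Dq qsub; have [ff pf qE] := penalized_fin lam0 qsub.1.
split=> // e e0.
have le0 : 0 < lam * e by rewrite mulr_gt0.
have [d1 d10 dP1] := (near_distP _ _).1 (phi_int_frechet phi_legendre Dq le0).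
have [d2 d20 dP2] := (near_distP _ _).1 Dq.
apply/(near_distP q); exists (Num.min d1 d2); first by rewrite lt_min d10.
move=> x; rewrite lt_min => /andP[/dP1 + /dP2/(phi_edom_fin phi_Gamma0) xp].
have [->|[a fx]] := gtNy_cases (f_gtNy x); first by rewrite leey.
have xf : f x \is a fin_num by rewrite fx.
have := qsub.2 x; rewrite qE (penalized_fine lam xf xp) lee_fin.
rewrite -(fineK ff) -(fineK xf) -EFinD lee_fin dotvZl dotvBl ler_norml.
move=> H1 /andP[_ H2].
have H3 : lam * e * `|x - q| <= lam * e * enorm (x - q).
  by rewrite ler_pM2l // norm_le_enorm.
rewrite -(ler_pM2l lam0) mulrDr mulrBr mulVKf ?gt_eqF //.
by move: H1 H2 H3 => /=; lra.
Qed.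

Section FixedParameter.
Variables (lam e r : R).
Hypotheses (lam0 : 0 < lam) (e0 : 0 < e).
Hypothesis eD : forall x, `|x - xbar| < e -> D x.
Hypothesis ineq : prox_regular_ineq e r.
Hypothesis psi_tiltable : tiltable (penalized lam).
Hypothesis lr1 : lam * r < 1.
Hypothesis psi_exposes : exposes (penalized lam) (G xbar + lam *: vbar) xbar.

Local Notation psi := (penalized lam).
Local Notation wbar := (G xbar + lam *: vbar).

Let psub w q : global_subgrad psi q w ->
  [/\ f q \is a fin_num, phi q \is a fin_num & fine (psi q) = lam * rf q + rphi q].
Proof. by move=> [/(penalized_fin lam0)]. Qed.

(** Stability of the minimizers brings [q] close to [xbar]; comparing the values of
    [psi] at [q] and [xbar] then bounds [f q]; and [(w - G q) / lam], a subgradient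
    of [f] at [q] by optimality, tends to [(wbar - G xbar) / lam = vbar]. So
    prox-regularity applies at [q]; its conclusion is stated multiplied by [lam]. *)
Lemma near_prox_regular_ineq (eta : R) : 0 < eta ->
  \forall w \near wbar, forall q, global_subgrad psi q w ->
    [/\ `|q - xbar| < e, `|q - xbar| < eta &
    forall x', `|x' - xbar| < e -> f x' \is a fin_num ->
      lam * rf q + dotv (w - G q) (x' - q) - lam * r * breg x' q <= lam * rf x'].
Proof.
move=> eta0.
have xp := phi_int_fin phi_Gamma0 xbar_int.
have le0 : 0 < lam * e / 2 by rewrite divr_gt0 ?mulr_gt0.
pose M := dimc m * (`|wbar| + 1).
have M0 : 0 < M by rewrite mulr_gt0 ?dimc_gt0 // ltr_wpDl.
have cphi : {for xbar, continuous rphi}.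
  have [[_ dphi _] _] := phi_legendre; have [_] := dphi _ xbar_int.
  exact: differentiable_continuous.
have [d1 d10 dP1] := (near_distP _ _).1 ((continuous_distP _ _).1 cphi _ le0).
have [d2 d20 dP2] := (near_distP _ _).1
  ((continuous_distP _ _).1 (grad_continuous xbar_int) _ le0).
pose d := Num.min (Num.min d1 d2) (Num.min (Num.min e eta) (lam * e / 2 / M)).
have d0 : 0 < d by rewrite !lt_min d10 d20 e0 eta0 divr_gt0.
have stable := exposed_stable psi_tiltable psi_exposes d0.
have nw : \forall w \near wbar, `|w - wbar| < Num.min 1 (lam * e / 2).
  by apply: near_dist; rewrite lt_min ltr01.
apply: filterS2 stable nw => w close ww q qsub.
have := close q qsub; rewrite !lt_min -!andbA => /and5P[qd1 qd2 qe qeta qM].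
split=> // x' x'e f'.
have [ff pf qE] := psub qsub.
have Dq := eD qe.
have vlim := regular_limiting (penalized_regular_subdiff lam0 Dq qsub).
have [w1 wl] : `|w - wbar| < 1 /\ `|w - wbar| < lam * e / 2.
  by move: ww; rewrite lt_min => /andP.
have val : rf q < rf xbar + e.
  have xE := penalized_fine lam xbar_fin xp.
  have := global_subgrad_fine qsub psi_exposes.1.1; rewrite qE xE /=.
  rewrite -(opprB q xbar) dotvNr => H1.
  have := dP1 q qd1; rewrite ltr_norml /= => /andP[H2 _].
  have H3 : dotv w (q - xbar) < lam * e / 2.
    apply: (le_lt_trans (dotv_le _ _)).
    have wM : dimc m * `|w| <= M.
      rewrite ler_pM2l ?dimc_gt0 //.
      have := ler_normD (w - wbar) wbar; rewrite subrK; lra.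
    rewrite mulrA; apply: (@le_lt_trans _ _ (M * `|q - xbar|)).
      by rewrite ler_wpM2r.
    by rewrite mulrC -ltr_pdivlMr.
  by rewrite -(ltr_pM2l lam0); move: H1 H2 H3 => /=; lra.
have vclose : `|lam^-1 *: (w - G q) - vbar| < e.
  have -> : lam^-1 *: (w - G q) - vbar = lam^-1 *: ((w - wbar) - (G q - G xbar)).
    rewrite -[vbar in LHS](scalerK (lt0r_neq0 lam0)) -scalerBr; congr (_ *: _).
    by apply/rowP => i; rewrite !mxE; ring.
  rewrite normrZ gtr0_norm ?invr_gt0 // ltr_pdivrMl //.
  apply: (le_lt_trans (ler_normB _ _)).
  by have := dP2 q qd2; lra.
have H : lam * (rf q + dotv (lam^-1 *: (w - G q)) (x' - q) - r * breg x' q) <=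
    lam * rf x' by rewrite ler_pM2l // ineq.
by move: H; rewrite mulrBr mulrDr dotvZl mulVKf ?gt_eqF // mulrA.
Qed.

Variable P : 'rV[R]_m -> 'rV[R]_m.
Hypothesis PP : forall w, global_subgrad psi (P w) w.

(** For two minimizers [p], [q] of the same tilt, prox-regularity at [p] gives
    [(1 - lam r) D(q, p) <= 0]. *)
Lemma near_exposes : \forall w \near wbar, exposes psi w (P w).
Proof.
apply: filterS (near_prox_regular_ineq e0) => w good.
split=> // q qsub; apply: contrapT => /eqP qP.
have [_ _ Pineq] := good _ (PP w); have [qe _ _] := good _ qsub.
have [fq pq qE] := psub qsub; have [fP pP PE] := psub (PP w).
have [Pe _ _] := good _ (PP w).
have H1 := Pineq q qe fq.
have := global_subgrad_fine qsub (PP w).1; rewrite qE PE => H2.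
have b0 := breg_gt0 (eD Pe) pq qP.
have : 0 < (1 - lam * r) * breg q (P w) by rewrite mulr_gt0 // subr_gt0.
move: H1 H2; rewrite -(opprB q (P w)) dotvNr dotvBl /breg /=; lra.
Qed.

Definition single_valued_at y : Prop := D y /\ exposes psi (G y) (P (G y)).

Lemma near_single_valued ybar : D ybar -> G ybar = wbar -> \forall y \near ybar, single_valued_at y.
Proof.
move=> Dy Gy; apply: filterI; first exact: nbhs_interior.
by have := near_exposes; rewrite -Gy => /(grad_continuous Dy).
Qed.

Lemma left_objE_fine y x : D y -> f x \is a fin_num -> phi x \is a fin_num ->
  left_obj phi lam f y x =
  (lam^-1 * (fine (psi x) - (rphi y + dotv (G y) (x - y))))%:E.
Proof. by move=> Dy ff pf; rewrite left_objE // penalized_fine. Qed.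

Lemma left_envE y : D y -> left_env phi lam f y =
  (lam^-1 * (fine (psi (P (G y))) - (rphi y + dotv (G y) (P (G y) - y))))%:E.
Proof.
move=> Dy; have [fP pP _] := psub (PP (G y)).
apply/eqP; rewrite eq_le; apply/andP; split.
  by apply: ereal_inf_lbound; exists (P (G y)) => //; rewrite left_objE_fine.
apply: le_ereal_inf_tmp => _ [x _ <-].
rewrite left_objE //; have := (PP (G y)).2 x.
case: (penalizedP x lam0) => [_ _|ff pf].
  by rewrite addye // gt0_muley ?leey // lte_fin invr_gt0.
rewrite -EFinB -EFinM !lee_fin ler_pM2l ?invr_gt0 // !dotvBr; lra.
Qed.

Lemma left_env_conjugate y : D y -> left_env phi lam f y =
  (lam^-1 * ((fine \o econjugate phi) (G y) - (fine \o econjugate psi) (G y)))%:E.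
Proof.
move=> Dy; rewrite left_envE // /=.
rewrite (econjugateE (phi_gtNy phi_Gamma0) (gradient_inequality phi_Gamma0 phi_legendre Dy)).
have [psiNy _ _ _] := psi_tiltable.
rewrite (econjugateE psiNy (PP (G y))) /=; congr (_%:E); congr (_ * _).
by rewrite dotvBr; ring.
Qed.

Lemma left_proxE y : single_valued_at y -> left_prox phi lam f y = [set P (G y)].
Proof.
move=> [Dy [_ uniq]]; rewrite /left_prox left_envE //; have [fP pP _] := psub (PP (G y)).
apply/seteqP; split=> [q [qE _]|q -> /=]; last first.
  by split; [rewrite left_objE_fine|exact: ltry].
apply: uniq; move: qE; rewrite left_objE //.
case: (penalizedP q lam0) (erefl (psi q)) => [_ _|ff pf qE].
  by rewrite addye // gt0_muley // lte_fin invr_gt0.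
rewrite -EFinB -EFinM => -[/(mulfI _) E].
have {}E : fine (psi q) = fine (psi (P (G y))) + dotv (G y) (q - P (G y)).
  rewrite penalized_fine //.
  have := E (lt0r_neq0 _); rewrite invr_gt0 => /(_ lam0); rewrite !dotvBr /=; lra.
split=> [|x]; first by rewrite penalized_fine.
rewrite E -addrA -dotvDr [q - _ + _]addrC addrA subrK; exact: (PP (G y)).2.
Qed.

Lemma left_env_frechet y : single_valued_at y ->
  frechet (fine \o left_env phi lam f) y
    (lam^-1 *: ((y - P (G y)) *m hessian phi y)).
Proof.
move=> [Dy ey]; have [_ dG _] := phi_C2 Dy.
have sym : (hessian phi y)^T = hessian phi y.
  apply: jacobian_grad_sym => //.
  have : \forall z \near y, D z by exact: nbhs_interior.
  by apply: filterS => z /phi_C2[[]].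
rewrite -sym; apply: frechet_near_eq; last first.
  apply: frechetZ; apply: (frechet_comp _ dG); apply: frechetB.
    exact: conjugate_frechet_grad.
  exact: (econjugate_frechet psi_tiltable PP ey).
have : \forall z \near y, D z by exact: nbhs_interior.
by apply: filterS => z Dz; rewrite /= left_env_conjugate.
Qed.

Lemma left_env_egrad y : single_valued_at y ->
  egrad (left_env phi lam f) y = lam^-1 *: ((y - P (G y)) *m hessian phi y).
Proof. by move=> /left_env_frechet/frechet_diff[]. Qed.

Lemma left_env_C1 : C1_on (left_env phi lam f) [set y | single_valued_at y]°.
Proof.
move=> y gy; have gy' : single_valued_at y by exact: interior_subset gy.
have [Dy ey] := gy'.
split.
  split; last by have [] := frechet_diff (left_env_frechet gy').
  have : \forall z \near y, D z by exact: nbhs_interior.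
  by apply: filterS => z Dz; rewrite left_envE.
suff : {for y, continuous
    (fun z => lam^-1 *: ((z - P (G z)) *m hessian phi z))}.
  by apply: near_eq_continuous; apply: filterS gy => z /left_env_egrad ->.
have cPG : {for y, continuous (P \o G)}.
  apply: continuous_comp; first exact: grad_continuous.
  exact: exposed_continuous psi_tiltable PP ey.
have [_ _ cH] := phi_C2 Dy.
have cM : {for y, continuous (fun z => (z - P (G z)) *m hessian phi z)}.
  apply: mulmx_continuous => //.
  exact: (cvgB (@cvg_id _ (nbhs y)) cPG).
exact: (cvgZl_tmp (k := lam^-1) cM).
Qed.

(** Adding the prox-regularity inequalities written from each minimizer to the other
    yields [(1 - lam r) <G p1 - G p2, p1 - p2> <= <w1 - w2, p1 - p2>]; strong
    monotonicity of [G] bounds the left-hand side from below. *)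
Lemma argmin_lipschitz (c d : R) : 0 < c -> 0 < d ->
  (forall x z, `|x - xbar| < d -> `|z - xbar| < d ->
    c * `|x - z| ^+ 2 <= dotv (G x - G z) (x - z)) ->
  exists2 L : R, 0 <= L &
    exists2 s : R, 0 < s & forall w1 w2, `|w1 - wbar| < s -> `|w2 - wbar| < s ->
      `|P w1 - P w2| <= L * `|w1 - w2|.
Proof.
move=> c0 d0 mono; have t0 : 0 < 1 - lam * r by rewrite subr_gt0.
have tc0 : 0 < (1 - lam * r) * c by rewrite mulr_gt0.
exists (dimc m / ((1 - lam * r) * c)); first by rewrite divr_ge0 // ltW // dimc_gt0.
have [s s0 sP] := (near_distP _ _).1 (near_prox_regular_ineq d0).
exists s => // w1 w2 /sP/(_ _ (PP w1))[p1e p1d ineq1] /sP/(_ _ (PP w2))[p2e p2d ineq2].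
have [f1 _ _] := psub (PP w1); have [f2 _ _] := psub (PP w2).
move: (ineq1 _ p2e f2) (ineq2 _ p1e f1) (mono _ _ p1d p2d).
clear ineq1 ineq2 p1e p2e p1d p2d.
move: (P w1) (P w2) f1 f2 => p1 p2 f1 f2 H1 H2 H3.
have [->|p12] := eqVneq p1 p2.
  by rewrite subrr normr0 mulr_ge0 // divr_ge0 // ltW // dimc_gt0.
have n0 : 0 < `|p1 - p2| by rewrite normr_gt0 subr_eq0.
have H : (1 - lam * r) * dotv (G p1 - G p2) (p1 - p2) <= dotv (w1 - w2) (p1 - p2).
  move: H1 H2; rewrite /breg -(opprB p1 p2) !dotvNr !dotvBl /=; lra.
have H3' : (1 - lam * r) * (c * `|p1 - p2| ^+ 2) <=
    (1 - lam * r) * dotv (G p1 - G p2) (p1 - p2) by rewrite ler_pM2l.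
have H4 := dotv_le (w1 - w2) (p1 - p2).
rewrite mulrAC ler_pdivlMr // -(ler_pM2r n0) [`|p1 - p2| * _]mulrC -!mulrA -expr2.
exact: le_trans H3' (le_trans H H4).
Qed.

Lemma left_env_grad_lipschitz ybar : D ybar -> G ybar = wbar ->
  very_strictly_convex phi -> locally_lipschitz (hessian phi) D ->
  exists2 W, nbhs ybar W & [lipschitz (egrad (left_env phi lam f)) y | y in W].
Proof.
move=> Dy Gy [_ _ Hpos] Hlip.
have dG y : D y -> differentiable G y by move=> /phi_C2[].
have cH y : D y -> {for y, continuous (hessian phi)} by move=> /phi_C2[].
have nearD y : D y -> \forall z \near y, D z by exact: nbhs_interior.
have [c [d [c0 d0 mono]]] : exists c d : R, [/\ 0 < c, 0 < d &
    forall x z, `|x - xbar| < d -> `|z - xbar| < d ->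
      c * `|x - z| ^+ 2 <= dotv (G x - G z) (x - z)].
  apply: strong_monotone; [|exact: cH|exact: Hpos].
  by apply: filterS (nearD _ xbar_int) => z; exact: dG.
have [L L0 [s s0 PL]] := argmin_lipschitz c0 d0 mono.
have [U Uy [K [_ KP]]] := Hlip ybar Dy.
pose LH := `|K| + 1; have KLH : K < LH.
  by apply: (le_lt_trans (ler_norm K)); rewrite ltrDl.
have HLip := KP LH KLH.
have LH0 : 0 <= LH by rewrite addr_ge0.
have near : \forall y \near ybar, [/\ single_valued_at y, U y, D y,
    `|G y - wbar| < s & `|hessian phi y - hessian phi ybar| < 1].
  have : \forall y \near ybar, single_valued_at y /\ U y by exact: filterI (near_single_valued Dy Gy) Uy.
  have := (continuous_distP _ _).1 (grad_continuous Dy) _ s0.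
  have := (continuous_distP _ _).1 (cH _ Dy) _ ltr01.
  rewrite Gy; apply: filterS3 => y H1 H2 [[Dy' ey] Uy'].
  by split.
have [e1 e10 eP] := (near_distP _ _).1 near.
pose e' := Num.min e1 1; have e'0 : 0 < e' by rewrite lt_min e10 ltr01.
pose M := `|hessian phi ybar| + 1; have M0 : 0 <= M by rewrite addr_ge0.
have HM y : `|y - ybar| < e' -> `|hessian phi y| <= M.
  rewrite lt_min => /andP[/eP[_ _ _ _ H] _].
  have := ler_normD (hessian phi y - hessian phi ybar) (hessian phi ybar).
  rewrite subrK => /le_trans; apply; rewrite addrC lerD2l; exact: ltW.
have dGe y : `|y - ybar| < e' -> differentiable G y.
  by rewrite lt_min => /andP[/eP[_ _ /dG]].
have GL := jacobian_lipschitz dGe HM.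
pose LG := dimc m * M; have LG0 : 0 <= LG by rewrite mulr_ge0 // ltW // dimc_gt0.
pose u y := y - P (G y).
pose Lu := 1 + L * LG; have Lu0 : 0 <= Lu by rewrite addr_ge0 // mulr_ge0.
have uL y z : `|y - ybar| < e' -> `|z - ybar| < e' -> `|u y - u z| <= Lu * `|y - z|.
  move=> ye ze.
  have [_ _ _ Gys _] : [/\ single_valued_at y, U y, D y, `|G y - wbar| < s &
      `|hessian phi y - hessian phi ybar| < 1].
    by apply: eP; move: ye; rewrite lt_min => /andP[].
  have [_ _ _ Gzs _] : [/\ single_valued_at z, U z, D z, `|G z - wbar| < s &
      `|hessian phi z - hessian phi ybar| < 1].
    by apply: eP; move: ze; rewrite lt_min => /andP[].
  have -> : u y - u z = (y - z) - (P (G y) - P (G z)).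
    by rewrite /u; apply/rowP => i; rewrite !mxE; ring.
  apply: (le_trans (ler_normB _ _)); rewrite /Lu mulrDl mul1r lerD2l -mulrA.
  apply: (le_trans (PL _ _ Gys Gzs)); rewrite ler_wpM2l //.
  exact: GL.
pose Mu := `|u ybar| + Lu; have Mu0 : 0 <= Mu by rewrite addr_ge0.
have uM y : `|y - ybar| < e' -> `|u y| <= Mu.
  move=> ye; have yb : `|ybar - ybar| < e' by rewrite subrr normr0.
  have := ler_normD (u y - u ybar) (u ybar); rewrite subrK => /le_trans; apply.
  rewrite /Mu addrC lerD2l; apply: (le_trans (uL _ _ ye yb)).
  by rewrite ler_piMr // ltW // (lt_le_trans ye) // ge_min lexx orbT.
exists [set y | `|y - ybar| < e']; first exact: (near_dist ybar e'0).
apply: (@klipschitzW _ _ _ (lam^-1 * (dimc m * (Lu * M) + dimc m * (Mu * LH)))).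
  by apply: (globally_properfilter (a := (ybar, ybar))); rewrite /= subrr normr0.
move=> [y z] [/= ye ze].
have [gy Uy' Dy' _ _] : [/\ single_valued_at y, U y, D y, `|G y - wbar| < s &
    `|hessian phi y - hessian phi ybar| < 1].
  by apply: eP; move: ye; rewrite lt_min => /andP[].
have [gz Uz Dz _ _] : [/\ single_valued_at z, U z, D z, `|G z - wbar| < s &
    `|hessian phi z - hessian phi ybar| < 1].
  by apply: eP; move: ze; rewrite lt_min => /andP[].
rewrite !left_env_egrad // -scalerBr normrZ gtr0_norm ?invr_gt0 // -mulrA.
rewrite ler_pM2l ?invr_gt0 //; apply: (le_trans (mulmx_dist _ _ _ _)).
rewrite mulrDl -!mulrA; apply: lerD; rewrite ler_pM2l ?dimc_gt0 //.
  by rewrite mulrCA mulrC ler_pM // ?uL // HM.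
by rewrite ler_pM // ?uM //; exact: (HLip (y, z)).
Qed.

End FixedParameter.
End LocalAnalysis.
End BregmanEnvelope.

(** * Smoothness of the envelope *)

Theorem corollary3p34 (R : realType) (m : nat)
    (phi f : 'rV[R]_m -> \bar R) (xbar vbar : 'rV[R]_m)
    (phi_Gamma0 : Gamma0 phi) (phi_legendre : legendre phi)
    (phi_coercive : super_coercive phi) (phi_C2 : C2_on phi (edom phi)°)
    (f_proper : eproper f) (f_lsc : lower_semicontinuous f)
    (f_prox_bounded : prox_bounded phi f)
    (xbar_dom : ((edom phi)° `&` edom f) xbar)
    (vbar_sub : limiting_subdiff f xbar vbar)
    (f_prox_regular : relatively_prox_regular phi f xbar vbar) :
  exists2 lam0 : R, 0 < lam0 &
    forall lam : R, 0 < lam -> (lam%:E < prox_threshold phi f)%E ->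
      lam < lam0 ->
      let ybar := egrad (econjugate phi) (egrad phi xbar + lam *: vbar) in
      let env := left_env phi lam f in
      [/\ (exists2 U, open_nbhs ybar U & C1_on env U),
          (\forall y \near ybar, exists2 p, left_prox phi lam f y = [set p] &
             egrad env y = lam^-1 *: ((y - p) *m hessian phi y))
        & very_strictly_convex phi ->
          locally_lipschitz (hessian phi) (edom phi)° ->
          exists2 W, nbhs ybar W & [lipschitz (egrad env) y | y in W]].
Proof.
have [xbar_int xbar_f] := xbar_dom.
have xbar_fin : f xbar \is a fin_num by case: vbar_sub.
have [e [r [e0 r0 eD ineq]]] :=
  relatively_prox_regular_ineq phi_Gamma0 xbar_fin f_prox_regular.
have [lam0 lam00 main] := penalized_exposes phi_Gamma0 phi_legendre phi_coercive
  f_proper f_lsc xbar_int xbar_fin vbar_sub f_prox_bounded e0 r0 eD ineq.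
exists lam0 => // lam lam_gt0 _ lam_lt ybar env.
have [psi_tiltable lr1 psi_exposes] := main lam lam_gt0 lam_lt.
have [P PP] := choice (fun w => global_subgrad_exists w psi_tiltable).
have [p [Dp Gp pE _]] := grad_conjugate phi_Gamma0 phi_legendre phi_coercive
  (egrad phi xbar + lam *: vbar).
have {pE} ybarE : ybar = p by [].
rewrite -ybarE in Dp Gp.
have near : \forall y \near ybar, single_valued_at phi f lam P y.
  exact: (near_single_valued phi_Gamma0 phi_legendre phi_coercive f_proper phi_C2 xbar_int
    xbar_fin lam_gt0 e0 eD ineq psi_tiltable lr1 psi_exposes PP Dp Gp).
split.
- exists [set y | single_valued_at phi f lam P y]°.
    by split; [exact: open_interior|exact: near].
  exact: (left_env_C1 phi_Gamma0 phi_legendre phi_coercive f_proper phi_C2 lam_gt0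
    psi_tiltable PP).
- apply: filterS near => y gy; exists (P (egrad phi y)).
    exact: (left_proxE phi_Gamma0 f_proper lam_gt0 PP gy).
  exact: (left_env_egrad phi_Gamma0 phi_legendre phi_coercive f_proper phi_C2 lam_gt0
    psi_tiltable PP gy).
- exact: (left_env_grad_lipschitz phi_Gamma0 phi_legendre phi_coercive f_proper
    phi_C2 xbar_int xbar_fin lam_gt0 e0 eD ineq psi_tiltable lr1 psi_exposes PP Dp Gp).
Qed.
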